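(* Consider smooth heaps and slim heaps, with the operations make-heap, find-min, insert, meld, delete-min, decrease-key and delete implemented as described in the context. For every finite sequence of these operations, starting with no heaps, the total running time is $O\big(\sum_i c_i\big)$, where for the $i$-th operation, performed on a heap (or, for meld, producing a heap) containing $n_i$ nodes at the time of the operation, $c_i = 1+\lg n_i$ if the operation is delete-min or delete, $c_i = \max(1,\lg\lg n_i)$ if it is decrease-key, and $c_i = 1$ if it is make-heap, find-min, insert or meld. That is, delete-min and delete take $O(\lg n)$ amortized time, decrease-key takes $O(\lg\lg n)$ amortized time, and make-heap, find-min, insert and meld take $O(1)$ amortized time.
   Context: $\lg$ denotes the base-two logarithm. A heap stores a set of nodes, each with a real key, as a forest of rooted ordered trees in heap order (a child's key is at least its parent's key). The roots form a root list (identify front with ''left''), with a root of minimum key (the min-root) first; each node has an ordered list of children. A heap also has a buffer (a set of roots, initially empty), stores its number of nodes $n$, and maintains the minimum-key root among the buffer and among the root list. Key comparisons use the strict total order $\prec$: $a \prec b$ iff $\mathrm{key}(a)<\mathrm{key}(b)$, or the keys are equal and $a$ lies to the right of $b$ in the current list. A link of two nodes adjacent in a list (root list or sibling list) makes the $\prec$-smaller one (the winner) the parent of the other (the loser), removing the loser from the list; it is a left link if the loser was left of the winner, a right link otherwise. In a slim heap the loser always becomes the new leftmost child of the winner; in a smooth heap the loser becomes the new leftmost child after a left link and the new rightmost child after a right link. Each link costs $O(1)$ time. Leftmost locally maximum linking of a list: while more than one node remains, let $v$ be the leftmost node that is $\prec$-larger than each of its existing neighbours in the list, and link $v$ with whichever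 existing neighbour is $\prec$-larger. Operations: make-heap creates an empty heap; find-min returns the minimum-key root (over root list and buffer); insert$(x,h)$ makes $x$ a one-node tree placed first in the root list if its key is smaller than the min-root's, second otherwise (no links); meld$(h,h')$ first empties the buffer of the heap with fewer nodes, then concatenates the root lists, keeps the buffer of the larger heap, and sets the min-root. Emptying a buffer: sort its roots in non-increasing key order (comparison sort), apply leftmost locally maximum linking to that sorted list, and add the resulting root to the root list. delete-min$(h)$: empty the buffer; delete the min-root $x$ and replace it in the root list by its children in their list order (so they precede the remaining roots); apply leftmost locally maximum linking to the whole root list until one root remains, which becomes the min-root. decrease-key$(x,k,h)$ (given a pointer to $x$ and $k \le \mathrm{key}(x)$): set $\mathrm{key}(x)=k$; if $x$ is not a root, cut $x$ (with its subtree) from its sibling list $L$, and if $x$ has a child, cut its leftmost child $y$ (with its subtree) from $x$ and put $y$ in $x$'s former place in $L$; then add $x$ to the buffer, and if the buffer contains at least $\lg n$ roots, empty it; finally update the minimum. delete$(x,h)$: if $x$ is the min-root, do delete-min; otherwise repeatedly link adjacent children of $x$ by leftmost locally maximum linking until $x$ has at most one child, and replace $x$ by that child (if any) in the list containing $x$. All operations other than links and buffer sorting take $O(1)$ time per elementary pointer step. *)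

(* Defs.v *)
From HB Require Import structures.
From mathcomp Require Import all_boot all_order all_algebra.
From mathcomp Require Import all_classical all_reals all_analysis.

Set Implicit Arguments.
Unset Strict Implicit.
Unset Printing Implicit Defensive.

Import Order.TTheory GRing.Theory Num.Theory.
Local Open Scope ring_scope.

Inductive variant := Slim | Smooth.

(* [Node x a c]: the node named [x] (playing the role of a pointer), with key
   [a] and ordered list of children [c], leftmost first. *)
Inductive tree (K : Type) : Type := Node of nat & K & seq (tree K).

Section Heaps.
Context (R : realType).
Implicit Types (v : variant) (t : tree R) (l : seq (tree R)) (x i j : nat).

Definition lg (a : R) : R := ln a / ln 2.

Definition name t : nat := let: Node x _ _ := t in x.
Definition key t : R := let: Node _ a _ := t in a.
Definition children t : seq (tree R) := let: Node _ _ c := t in c.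

Fixpoint subtrees t : seq (tree R) :=
  let: Node _ _ c := t in t :: flatten [seq subtrees s | s <- c].

(* In every list of siblings or roots, replace the subtree rooted at [x] by
   the list of trees [f] returns on it. *)
Fixpoint splice_tree x (f : tree R -> seq (tree R)) t : seq (tree R) :=
  let: Node y a c := t in
  if y == x then f t
  else [:: Node y a (flatten [seq splice_tree x f s | s <- c])].

Definition splice x (f : tree R -> seq (tree R)) l : seq (tree R) :=
  flatten [seq splice_tree x f t | t <- l].

(* Link of [a] and [b], where [a] is immediately to the left of [b]; since ties
   are broken to the right, [a] precedes [b] iff its key is strictly smaller. *)
Definition link v (a b : tree R) : tree R :=
  if key a < key b then
    Node (name a) (key a)
      (if v is Smooth then rcons (children a) b else b :: children a)
  else Node (name b) (key b) (a :: children b).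

Definition nth_tree l i : tree R := nth (Node 0%N 0 [::]) l i.

Definition link_at v l i : seq (tree R) :=
  take i l ++ link v (nth_tree l i) (nth_tree l i.+1) :: drop i.+2 l.

(* The strict total order on the positions of [l]. *)
Definition prec l i j : bool :=
  let a := key (nth_tree l i) in let b := key (nth_tree l j) in
  (a < b) || ((a == b) && (j < i)%N).

Definition local_max l i : bool :=
  ((0 < i)%N ==> prec l i.-1 i) && ((i.+1 < size l)%N ==> prec l i.+1 i).

Definition leftmost_local_max l : nat :=
  find (local_max l) (iota 0%N (size l)).

Definition llm_step v l : seq (tree R) :=
  let i := leftmost_local_max l in
  let with_right := (i.+1 < size l)%N && ((i == 0%N) || prec l i.-1 i.+1) in
  link_at v l (if with_right then i else i.-1).

(* Leftmost locally maximum linking; every link shortens the list by one. *)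
Definition llm v l : seq (tree R) := iter (size l).-1 (llm_step v) l.

(* Time of leftmost locally maximum linking on a list of length [m]: [m] steps
   to traverse the list and one unit for each of the [m.-1] links. *)
Definition llm_time (m : nat) : nat := (m + m.-1)%N.

(* The buffer is a set; its enumeration order only serves to break ties when it
   is sorted. *)
Record heap := Heap { roots : seq (tree R); buffer : seq (tree R) }.
Implicit Types h : heap.

Definition heap_subtrees h : seq (tree R) :=
  flatten [seq subtrees t | t <- roots h ++ buffer h].
Definition nodes h : seq nat := [seq name t | t <- heap_subtrees h].
Definition hsize h : nat := size (heap_subtrees h).
Definition find_node x h : option (tree R) :=
  ohead [seq t <- heap_subtrees h | name t == x].
Definition is_root x h : bool := x \in [seq name t | t <- roots h ++ buffer h].

Definition sort_buffer l : seq (tree R) :=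
  sort (fun s t => key t <= key s) l.

(* The root of minimum key among all roots.  The operations keep a root of
   minimum key first in the root list or in the buffer, so that the remaining
   roots need not be examined.  Ties are resolved in favour of
   the front of the root list, then of the root that wins when the buffer is
   emptied (the last one in sorted order). *)
Definition min_root h : option (tree R) :=
  let candidates := take 1 (roots h) ++ rev (sort_buffer (buffer h)) in
  ohead [seq t <- candidates | all (fun s => key t <= key s) candidates].

Definition add_root t h : heap :=
  let first := if min_root h is Some m then key t < key m else true in
  Heap (if first then t :: roots h
        else take 1 (roots h) ++ t :: drop 1 (roots h))
       (buffer h).

(* The operations return the resulting heap and the time spent in linking and
   sorting; sorting [b] roots by comparisons takes [b * up_log 2 b] steps. *)
Definition empty_buffer v h : heap * nat :=
  let b := size (buffer h) in
  let h0 := Heap (roots h) [::] in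
  (foldr add_root h0 (llm v (sort_buffer (buffer h))),
   (b * up_log 2 b + llm_time b)%N).

Definition insert x (a : R) h : heap := add_root (Node x a [::]) h.

(* The root list starting with the smaller key comes first, so that the
   min-root ends up at the front. *)
Definition cat_roots l1 l2 : seq (tree R) :=
  match l1, l2 with
  | t1 :: _, t2 :: _ => if key t2 < key t1 then l2 ++ l1 else l1 ++ l2
  | _, _ => l1 ++ l2
  end.

Definition meld v h1 h2 : heap * nat :=
  if (hsize h1 < hsize h2)%N then
    let: (h, t) := empty_buffer v h1 in
    (Heap (cat_roots (roots h) (roots h2)) (buffer h2), t)
  else
    let: (h, t) := empty_buffer v h2 in
    (Heap (cat_roots (roots h1) (roots h)) (buffer h1), t).

Definition delete_min v h : heap * nat :=
  let: (h1, t) := empty_buffer v h in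
  if roots h1 is r :: rs then
    let l := children r ++ rs in
    (Heap (llm v l) [::], (t + llm_time (size l))%N)
  else (h1, t).

(* A root enters the buffer with its whole tree; a non-root leaves its leftmost
   child, if any, in its former place. *)
Definition detach x (a : R) h : heap :=
  if find_node x h is Some t then
    let: (left_behind, kept) :=
      if is_root x h then ([::], children t)
      else (take 1 (children t), drop 1 (children t)) in
    let cut := splice x (fun _ => left_behind) in
    Heap (cut (roots h)) (rcons (cut (buffer h)) (Node x a kept))
  else h.

Definition decrease_key v x (a : R) h : heap * nat :=
  let h1 := detach x a h in
  if lg (hsize h1)%:R <= (size (buffer h1))%:R then empty_buffer v h1
  else (h1, 0%N).

Definition delete v x h : heap * nat :=
  if omap name (min_root h) == Some x then delete_min v h
  else
    let replace := splice x (fun t => llm v (children t)) in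
    (Heap (replace (roots h)) (replace (buffer h)),
     if find_node x h is Some t then llm_time (size (children t)) else 0%N).

(* Existing heaps are designated by natural numbers. *)
Definition state := nat -> option heap.

Definition no_heaps : state := fun _ => None.

Definition update (st : state) i (o : option heap) : state :=
  fun j => if j == i then o else st j.

Inductive operation :=
  | MakeHeap of nat
  | FindMin of nat
  | Insert of nat & R & nat
  | Meld of nat & nat
  | DeleteMin of nat
  | DecreaseKey of nat & R & nat
  | Delete of nat & nat.

(* [step v st op n time st']: in state [st], operation [op] is legal, concerns a
   heap of [n] nodes, and leads to state [st'] in the given time, which includes
   one unit for the constant-time work of the operation. *)
Inductive step v (st : state) : operation -> nat -> nat -> state -> Prop :=
  | StepMakeHeap i :
      st i = None ->
      step v st (MakeHeap i) 0%N 1%N (update st i (Some (Heap [::] [::])))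
  | StepFindMin i h :
      st i = Some h ->
      step v st (FindMin i) (hsize h) 1%N st
  | StepInsert x a i h :
      st i = Some h ->
      (forall j h', st j = Some h' -> x \notin nodes h') ->
      step v st (Insert x a i) (hsize h) 1%N (update st i (Some (insert x a h)))
  | StepMeld i j h1 h2 h time :
      i != j -> st i = Some h1 -> st j = Some h2 ->
      meld v h1 h2 = (h, time) ->
      step v st (Meld i j) (hsize h) time.+1
        (update (update st j None) i (Some h))
  | StepDeleteMin i h h' time :
      st i = Some h -> (0 < hsize h)%N ->
      delete_min v h = (h', time) ->
      step v st (DeleteMin i) (hsize h) time.+1 (update st i (Some h'))
  | StepDecreaseKey x a i h t h' time :
      st i = Some h -> find_node x h = Some t -> a <= key t ->
      decrease_key v x a h = (h', time) ->
      step v st (DecreaseKey x a i) (hsize h) time.+1 (update st i (Some h'))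
  | StepDelete x i h h' time :
      st i = Some h -> x \in nodes h ->
      delete v x h = (h', time) ->
      step v st (Delete x i) (hsize h) time.+1 (update st i (Some h')).

(* As [ln] vanishes outside the positive reals, the bound for [DecreaseKey] is
   1 when [n = 1]. *)
Definition bound (op : operation) (n : nat) : R :=
  match op with
  | DeleteMin _ | Delete _ _ => 1 + lg n%:R
  | DecreaseKey _ _ _ => Num.max 1 (lg (lg n%:R))
  | MakeHeap _ | FindMin _ | Insert _ _ _ | Meld _ _ => 1
  end.

(* [run v st ops T B st']: the sequence [ops] is legal from [st], takes total
   time [T], has bounds summing to [B], and leads to [st']. *)
Inductive run v : state -> seq operation -> nat -> R -> state -> Prop :=
  | RunNil st : run v st [::] 0%N 0 st
  | RunCons st op n time st1 ops T B st2 :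
      step v st op n time st1 -> run v st1 ops T B st2 ->
      run v st (op :: ops) (time + T)%N (bound op n + B) st2.

End Heaps.

(* Main.v *)
Require Import Defs.
From HB Require Import structures.
From mathcomp Require Import all_boot all_order all_algebra.
From mathcomp Require Import all_classical all_reals all_analysis.
From mathcomp Require Import zify ring lra.
(* [roots] is also a name of fingraph. *)
Import Defs.

Set Implicit Arguments.
Unset Strict Implicit.
Unset Printing Implicit Defensive.

Import Order.TTheory GRing.Theory Num.Theory.
Local Open Scope ring_scope.

(* In leftmost locally maximum linking, every gap between two list neighbours
   disappears by exactly one link, won by the [prec]-smaller neighbour.  Hence a
   node wins at most one link from each side, and a quantity charged per link to
   the size of the winner is at most the sum over the gaps of the logarithm of
   the larger neighbour.

   The potential of a child is the logarithm of 1 plus the total size of its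
   siblings further right, its next sibling excluded.  Suffix sums
   telescope, so deleting a node releases this sum over the gaps plus a constant
   per child, up to O(lg n).  Excluding the next sibling makes a second new
   child in the same round as cheap as the first.  In smooth heaps the list of
   children is split into a part where the siblings to the right count and a
   part where those to the left count; the cheapest split is taken.

   When x is cut, its leftmost child takes its place; sizes of siblings then only
   decrease, and the former potential of that child stays with x in the buffer.
   It pays exactly for the one child that x wins when the sorted buffer is
   linked into a path.  Finally beta(b) = b ln b + 3b pays for sorting b roots,
   and its increments are O(lg lg n) as b < lg n. *)

(** * Costs of lists of sizes *)

Section Potential.
Context {R : realType}.
Implicit Types (v : variant) (t s : tree R) (c l : seq (tree R)).
Implicit Types (m L M : seq nat).

Definition lnn (n : nat) : R := ln n%:R.

Lemma lnn0 : lnn 0 = 0. Proof. by rewrite /lnn ln0. Qed.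
Lemma lnn1 : lnn 1 = 0. Proof. by rewrite /lnn ln1. Qed.

(** The case [a = 0] fits in because [ln] vanishes at 0 and is nonnegative from 1 on. *)
Lemma ler_lnn a b : (a <= b)%N -> lnn a <= lnn b.
Proof.
case: a => [|a] ab.
  rewrite lnn0; case: b {ab} => [|b]; first by rewrite lnn0.
  by rewrite ln_ge0 // ler1n.
by rewrite ler_ln ?ler_nat // posrE ltr0n //; apply: leq_trans ab.
Qed.

Lemma lnn_ge0 n : 0 <= lnn n.
Proof. by rewrite -lnn0 ler_lnn. Qed.

Lemma lnnM a b : (0 < a)%N -> (0 < b)%N -> lnn (a * b) = lnn a + lnn b.
Proof. by move=> a0 b0; rewrite /lnn natrM lnM // posrE ltr0n. Qed.

(** The potential that pays for one unit of time. It is what a logarithm gains when its argument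
    doubles. *)
Definition kappa : R := lnn 2.

Lemma kappa_gt0 : 0 < kappa.
Proof. by rewrite /kappa ln_gt0 // ltr1n. Qed.

Lemma lnn_le_pred n : lnn n.+1 <= n%:R.
Proof.
rewrite /lnn -natr1 addrC.
have := @le_ln1Dx R n%:R; apply.
by apply: lt_le_trans (ler0n _ _); rewrite oppr_lt0.
Qed.

Lemma kappa_le1 : kappa <= 1.
Proof. exact: lnn_le_pred 1. Qed.

Fixpoint gap_cost m : R :=
  if m is a :: ((b :: _) as m') then lnn (maxn a b) + gap_cost m' else 0.

Fixpoint sibling_cost m : R :=
  if m is _ :: m' then lnn (sumn (behead m')).+1 + sibling_cost m' else 0.

Lemma sibling_cost_ge0 m : 0 <= sibling_cost m.
Proof. by elim: m => //= a m IH; rewrite addr_ge0 ?lnn_ge0. Qed.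

Lemma gap_cost_ge0 m : 0 <= gap_cost m.
Proof.
by elim: m => //= a m IH; case: m IH => //= b m IH; rewrite addr_ge0 ?lnn_ge0.
Qed.

(** Joining two lists creates one new gap, and its larger neighbour is at most the whole sum. *)
Lemma gap_cost_cat m1 m2 :
  gap_cost (m1 ++ m2) <= gap_cost m1 + gap_cost m2 + lnn (sumn (m1 ++ m2)).
Proof.
elim: m1 => [|a m1 IH] /=; first by rewrite add0r lerDl lnn_ge0.
case: m1 IH => [|b m1] IH /=.
  case: m2 IH => [|b m2] /= _; first by rewrite !add0r lnn_ge0.
  rewrite add0r addrC lerD2l; apply: ler_lnn; lia.
rewrite -!addrA lerD2l addrA; apply: le_trans IH _.
by rewrite lerD2l; apply: ler_lnn; rewrite /= leq_addl.
Qed.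

Lemma gap_cost_rcons2 m a b :
  gap_cost (rcons (rcons m a) b) = gap_cost (rcons m a) + lnn (maxn a b).
Proof.
elim: m => [|x m IH] /=; first by rewrite addr0 add0r.
by case: m IH => [|y m] /= ->; rewrite addrA.
Qed.

Lemma gap_cost_rev m : gap_cost (rev m) = gap_cost m.
Proof.
elim: m => // a m IH; case: m IH => // b m IH.
by rewrite !rev_cons gap_cost_rcons2 -rev_cons IH maxnC addrC.
Qed.

(** Without logarithms this reads [2 x S^2 <= (y + S)^3] with [x = maxn a b] and [y = a + b >= x];
    the cube already contains [3 y S^2]. *)
Lemma kappa_gap a b S : (0 < a)%N -> (0 < S)%N ->
  kappa + lnn (maxn a b) + 2 * lnn S <= 3 * lnn (a + b + S).
Proof.
move=> a0 S0; have m0 : (0 < maxn a b)%N by lia.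
have -> : 3 * lnn (a + b + S) = lnn ((a + b + S) * (a + b + S) * (a + b + S)).
  rewrite !lnnM ?muln_gt0 ?addn_gt0 ?S0 ?orbT //; ring.
rewrite mulr_natl mulr2n -!lnnM ?muln_gt0 ?S0 ?m0 //; apply: ler_lnn.
have : (maxn a b <= a + b)%N by lia.
move: (maxn a b) (a + b)%N => x y xy; nia.
Qed.

(** Sibling costs skip the next sibling, so a first entry followed by [b] contributes only [ln S],
    with [S] one more than the sum beyond [b]. The two logarithmic terms on the right telescope over
    two positions, and [kappa_gap] compares consecutive bounds. *)
Lemma gap_cost_sibling m : all (leq 1) m ->
  kappa * (size m)%:R + gap_cost m <=
  sibling_cost m + 3 * lnn (sumn m).+1 + 3 * lnn (sumn (behead m)).+1 + kappa.
Proof.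
have k0 := kappa_gt0.
elim: m => [_|a m IH] /=.
  by rewrite mulr0 lnn1; lra.
case: m IH => [|b m] /= IH /andP[a0 pos].
  have := lnn_ge0 (a + 0).+1; rewrite lnn1; lra.
have {}IH := IH pos.
have := @kappa_gap a b (sumn m).+1 a0 isT.
rewrite (_ : (a + b + _ = (a + (b + sumn m)).+1)%N); last by lia.
rewrite -natr1; lra.
Qed.

Lemma gap_cost_sibling_le m : all (leq 1) m ->
  kappa * (size m)%:R + gap_cost m <=
  sibling_cost m + 6 * lnn (sumn m).+1 + kappa.
Proof.
move/gap_cost_sibling => h; apply: le_trans h _.
have : lnn (sumn (behead m)).+1 <= lnn (sumn m).+1.
  by apply: ler_lnn; case: m => //= a m; lia.
lra.
Qed.

(** The effect of a cut on the sizes in a sibling list: entries disappear or decrease. All costs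
    below are monotone in it. *)
Inductive shrink : seq nat -> seq nat -> Prop :=
  | ShrinkNil : shrink [::] [::]
  | ShrinkDrop m' a m : shrink m' m -> shrink m' (a :: m)
  | ShrinkCons m' a' a m :
      (a' <= a)%N -> shrink m' m -> shrink (a' :: m') (a :: m).

Lemma shrink_refl m : shrink m m.
Proof. by elim: m => [|a m IH]; constructor. Qed.

Lemma shrink_sumn m' m : shrink m' m -> (sumn m' <= sumn m)%N.
Proof. by elim=> //= *; lia. Qed.

Lemma shrink_behead m' m :
  shrink m' m -> (sumn (behead m') <= sumn (behead m))%N.
Proof.
case=> //= [{}m' a {}m /shrink_sumn|{}m' a' a {}m _ /shrink_sumn //].
by case: m' => //= *; lia.
Qed.

Lemma shrink_cat m1' m1 m2' m2 :
  shrink m1' m1 -> shrink m2' m2 -> shrink (m1' ++ m2') (m1 ++ m2).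
Proof. by move=> h1 h2; elim: h1 => //= *; constructor. Qed.

Lemma shrink_rev m' m : shrink m' m -> shrink (rev m') (rev m).
Proof.
elim=> [|{}m' a {}m _ IH|{}m' a' a {}m le _ IH]; first exact: ShrinkNil.
  rewrite rev_cons -cats1 -[rev m']cats0; apply: shrink_cat => //.
  exact/ShrinkDrop/ShrinkNil.
rewrite !rev_cons -!cats1; apply: shrink_cat => //.
exact/ShrinkCons/ShrinkNil.
Qed.

(** Carries a split of the larger list over to the smaller one, so that minima over splits are
    monotone. *)
Lemma shrink_catr m' L M : shrink m' (L ++ M) ->
  exists L' M', [/\ m' = L' ++ M', shrink L' L & shrink M' M].
Proof.
elim: L m' => [|a L IH] m' /=.
  by move=> h; exists [::], m'; split => //; constructor.
move E: (a :: L ++ M) => N h; case: h E => //.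
  move=> {}m' a' {}N h [? ?]; subst.
  have [L' [M' [-> hL hM]]] := IH _ h.
  by exists L', M'; split => //; constructor.
move=> {}m' a' a0 {}N le h [? ?]; subst.
have [L' [M' [-> hL hM]]] := IH _ h.
by exists (a' :: L'), M'; split => //; constructor.
Qed.

Lemma shrink_sibling_cost m' m :
  shrink m' m -> sibling_cost m' <= sibling_cost m.
Proof.
elim=> //= [{}m' a {}m _ IH|{}m' a' a {}m le h IH].
  by rewrite (le_trans IH) // lerDr lnn_ge0.
by rewrite lerD // ler_lnn // ltnS shrink_behead.
Qed.

(** A heap does not record which children came from left links. Minimizing over all splits makes the
    potential a function of the sizes alone, and any split known to an argument gives an upper
    bound. *)
Definition min_split (g : seq nat -> seq nat -> R) m : R :=
  let at_ (j : 'I_(size m).+1) := g (take j m) (drop j m) in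
  at_ [arg min_(j < ord0) at_ j]%O.

Lemma min_split_le g L M : min_split g (L ++ M) <= g L M.
Proof.
rewrite /min_split; case: Order.TotalTheory.arg_minP => // j _.
move=> /(_ (inord (size L)) isT).
have sL : (size L < (size (L ++ M)).+1)%N by rewrite size_cat ltnS leq_addr.
rewrite (inordK sL) (take_size_cat _ (erefl (size L))).
by rewrite (drop_size_cat _ (erefl (size L))).
Qed.

Lemma min_split_ex g m : exists L M, m = L ++ M /\ min_split g m = g L M.
Proof.
rewrite /min_split; set j := (X in take (nat_of_ord X) m).
by exists (take j m), (drop j m); rewrite cat_take_drop.
Qed.

Lemma min_split_shrink g m' m :
  (forall L' L M' M, shrink L' L -> shrink M' M -> g L' M' <= g L M) ->
  shrink m' m -> min_split g m' <= min_split g m.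
Proof.
move=> mono; have [L [M [-> ->]]] := min_split_ex g m.
move=> /shrink_catr[L' [M' [-> hL hM]]].
exact: le_trans (min_split_le _ _ _) (mono _ _ _ _ hL hM).
Qed.

Definition split_cost L M : R := sibling_cost L + sibling_cost (rev M).
(** The sibling cost that a new leftmost child put in front of [L] would have. *)
Definition carry L : R := lnn (sumn (behead L)).+1.

Definition list_cost := min_split split_cost.
Definition buffer_cost := min_split (fun L M => split_cost L M + carry L).

Lemma split_cost_ge0 L M : 0 <= split_cost L M.
Proof. by rewrite addr_ge0 ?sibling_cost_ge0. Qed.

Lemma list_cost_ge0 m : 0 <= list_cost m.
Proof.
rewrite /list_cost; have [L [M [_ ->]]] := min_split_ex split_cost m.
exact: split_cost_ge0.
Qed.

Lemma buffer_cost_ge0 m : 0 <= buffer_cost m.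
Proof.
rewrite /buffer_cost; set g := fun _ _ => _.
have [L [M [_ ->]]] := min_split_ex g m.
by rewrite addr_ge0 ?split_cost_ge0 ?lnn_ge0.
Qed.

Lemma list_cost_shrink m' m : shrink m' m -> list_cost m' <= list_cost m.
Proof.
apply: min_split_shrink => L' L M' M hL hM.
by rewrite lerD // shrink_sibling_cost //; apply: shrink_rev.
Qed.

Lemma buffer_cost_shrink m' m : shrink m' m -> buffer_cost m' <= buffer_cost m.
Proof.
apply: min_split_shrink => L' L M' M hL hM.
rewrite !lerD ?shrink_sibling_cost //; first exact: shrink_rev.
by rewrite ler_lnn // ltnS shrink_behead.
Qed.

Lemma list_cost_buffer m : list_cost m <= buffer_cost m.
Proof.
rewrite /buffer_cost; set g := fun _ _ => _.
have [L [M [-> ->]]] := min_split_ex g m.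
by rewrite (le_trans (min_split_le _ _ _)) // lerDl lnn_ge0.
Qed.

Lemma buffer_cost_list m : buffer_cost m <= list_cost m + lnn (sumn m).+1.
Proof.
rewrite /list_cost; have [L [M [-> ->]]] := min_split_ex split_cost m.
apply: le_trans (min_split_le _ _ _) _; rewrite lerD2l ler_lnn // ltnS sumn_cat.
by case: L => //= a L; lia.
Qed.

(** The new child joins the left part of the best split, and the carry turns into its cost. *)
Lemma list_cost_cons a m : list_cost (a :: m) <= buffer_cost m.
Proof.
rewrite /buffer_cost; set g := fun _ _ => _.
have [L [M [-> ->]]] := min_split_ex g m.
apply: le_trans (min_split_le _ (a :: L) M) _.
by rewrite /g /split_cost /= /carry; lra.
Qed.

(* Without left children, the leftmost child is the oldest right child, the
   last entry of [rev M], whose cost is zero. *)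
Lemma buffer_cost_behead a m : buffer_cost m <= list_cost (a :: m).
Proof.
rewrite /list_cost; have [L [M [E ->]]] := min_split_ex split_cost (a :: m).
case: L E => [|b L] /= E.
  apply: le_trans (min_split_le _ [::] m) _.
  rewrite /split_cost /carry /= lnn1 -E !addr0 !add0r.
  apply: shrink_sibling_cost; apply: shrink_rev; apply: ShrinkDrop.
  exact: shrink_refl.
case: E => _ ->; apply: le_trans (min_split_le _ L M) _.
by rewrite /split_cost /carry /=; lra.
Qed.

(** Each part of the best split contributes 6 logarithms and one [kappa]; the gap between the parts
    is the 13th logarithm. *)
Lemma gap_cost_list m : all (leq 1) m ->
  kappa * (size m)%:R + gap_cost m <=
  list_cost m + 13 * lnn (sumn m).+1 + 2 * kappa.
Proof.
rewrite /list_cost; have [L [M [-> ->]]] := min_split_ex split_cost m.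
rewrite all_cat => /andP[posL posM].
have hL := gap_cost_sibling_le posL.
have hM : kappa * (size (rev M))%:R + gap_cost (rev M) <=
    sibling_cost (rev M) + 6 * lnn (sumn (rev M)).+1 + kappa.
  by apply: gap_cost_sibling_le; rewrite all_rev.
rewrite gap_cost_rev size_rev sumn_rev in hM.
have := gap_cost_cat L M.
rewrite size_cat natrD mulrDr /split_cost.
have le1 : lnn (sumn L).+1 <= lnn (sumn (L ++ M)).+1.
  by apply: ler_lnn; rewrite sumn_cat; lia.
have le2 : lnn (sumn M).+1 <= lnn (sumn (L ++ M)).+1.
  by apply: ler_lnn; rewrite sumn_cat; lia.
have le3 : lnn (sumn (L ++ M)) <= lnn (sumn (L ++ M)).+1.
  by apply: ler_lnn.
lra.
Qed.

(** * The cost of sorting and linking a buffer of given length *)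

Definition beta (b : nat) : R := b%:R * lnn b + 3 * b%:R.

Lemma beta0 : beta 0 = 0. Proof. by rewrite /beta !mul0r mulr0 addr0. Qed.

Lemma beta_ge b : 3 * b%:R <= beta b.
Proof. by rewrite /beta lerDr mulr_ge0 ?lnn_ge0. Qed.

Lemma beta_le a b : (a <= b)%N -> beta a <= beta b.
Proof.
move=> ab; rewrite /beta lerD //.
  by rewrite ler_pM ?lnn_ge0 ?ler_nat ?ler_lnn.
by rewrite ler_pM2l ?ler_nat.
Qed.

Lemma beta_succ b : beta b.+1 <= beta b + lnn b.+1 + 4.
Proof.
(* This is [b ln (1 + 1/b) <= 1]; together with the increment 3 of [3b] it gives the constant 4. *)
suff h : b%:R * lnn b.+1 <= b%:R * lnn b + 1.
  by rewrite /beta -natr1 mulrDl mul1r; lra.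
case: b => [|b]; first by rewrite !mul0r add0r.
have b0 : (0 : R) < b.+1%:R by rewrite ltr0n.
have -> : lnn b.+2 = lnn b.+1 + ln (1 + b.+1%:R^-1).
  rewrite /lnn -lnM ?posrE ?addr_gt0 ?invr_gt0 //.
  by rewrite mulrDr mulr1 mulfV ?gt_eqF // -natr1 natr1.
have : ln (1 + b.+1%:R^-1) <= b.+1%:R^-1 :> R.
  apply: le_ln1Dx; apply: lt_le_trans (_ : 0 <= _).
    by rewrite oppr_lt0.
  by rewrite invr_ge0 ltW.
move=> /(ler_wpM2l (ltW b0)); rewrite mulfV ?gt_eqF //; lra.
Qed.

Lemma beta_succ2 b : beta b.+1 <= 2 * beta b + 4.
Proof.
have := beta_succ b; have := lnn_le_pred b; have := beta_ge b.
have : (0 : R) <= b%:R by []. lra.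
Qed.

(** Rounding the logarithm up costs one [kappa] per root and linking at most two; as [kappa <= 1],
    the term [3b] of [beta] covers both. *)
Lemma sorting_time b :
  kappa * (b * up_log 2 b + llm_time b)%:R <= beta b.
Proof.
have k0 := kappa_gt0; have k1 := kappa_le1.
have h : kappa * (up_log 2 b)%:R <= lnn b + kappa.
  have [b1|b1] := leqP b 1%N.
    have /eqP -> : up_log 2 b == 0 by rewrite up_log_eq0 b1 orbT.
    by rewrite mulr0 addr_ge0 ?lnn_ge0 ?ltW.
  have := ler_lnn (ltnW (up_log_gtn (isT : 1 < 2)%N b1)).
  have -> : lnn (2 ^ (up_log 2 b).-1) = kappa * (up_log 2 b).-1%:R.
    by rewrite /lnn natrX lnXn // mulr_natr.
  have : (0 < up_log 2 b)%N by rewrite up_log_gt0.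
  by case: (up_log 2 b) => //= e _; rewrite -natr1; lra.
have b0 : (0 : R) <= b%:R by [].
have hl : (llm_time b)%:R <= 2 * b%:R :> R.
  by rewrite -natrM ler_nat /llm_time; lia.
rewrite natrD mulrDr natrM mulrCA /beta.
have := ler_wpM2l b0 h.
have := ler_wpM2l (ltW k0) hl.
have : kappa * b%:R <= b%:R by rewrite ler_piMl.
rewrite mulrDr; nra.
Qed.

End Potential.

(** * The potential of trees *)

Section Trees.
Context {R : realType}.
Implicit Types (v : variant) (t s : tree R) (c l : seq (tree R)).
Implicit Types (x y : nat) (a : R).
Local Notation lnn := (@lnn R).
Local Notation kappa := (@kappa R).

(** Trees are nested in lists, so the induction runs over forests, with one hypothesis for the
    children of the first tree and one for the trees after it. *)
Lemma forest_ind (P : seq (tree R) -> Prop) :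
  P [::] -> (forall x a c l, P c -> P l -> P (Node x a c :: l)) ->
  forall l, P l.
Proof.
move=> P0 P1.
have tree_case : forall t l, P l -> P (t :: l).
  fix IH 1; case=> x a c l Pl; apply: P1 => //.
  by elim: c => [|s c IHc]; [exact: P0 | exact: IH].
by elim=> // t l; apply: tree_case.
Qed.

Definition tree_size t : nat := size (subtrees t).
Definition forest_sizes l : seq nat := [seq tree_size t | t <- l].
Definition forest_names l : seq nat :=
  [seq name t | t <- flatten [seq subtrees t | t <- l]].

Lemma tree_sizeE x a c : tree_size (Node x a c) = (sumn (forest_sizes c)).+1.
Proof. by rewrite /tree_size /= size_flatten /shape -map_comp. Qed.

Lemma tree_size_gt0 t : (0 < tree_size t)%N. Proof. by case: t. Qed.

Lemma forest_sizes_pos l : all (leq 1) (forest_sizes l).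
Proof. by elim: l => //= t l ->; rewrite tree_size_gt0. Qed.

Lemma forest_sizes_cat c l : forest_sizes (c ++ l) = forest_sizes c ++ forest_sizes l.
Proof. exact: map_cat. Qed.

Lemma forest_names_cat c l :
  forest_names (c ++ l) = forest_names c ++ forest_names l.
Proof. by rewrite /forest_names map_cat flatten_cat map_cat. Qed.

Lemma forest_names_cons x a c l :
  forest_names (Node x a c :: l) = x :: forest_names c ++ forest_names l.
Proof. by rewrite /forest_names /= map_cat. Qed.

Lemma size_forest_names l : size (forest_names l) = sumn (forest_sizes l).
Proof. by rewrite /forest_names size_map size_flatten /shape -map_comp. Qed.

(** Charges every list of children inside [t], but nothing for the place of [t] among its own
    siblings. The sum over a mapped list keeps the recursion structural; [potE] gives the usable
    form. *)
Fixpoint pot t : R :=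
  let: Node _ _ c := t in
  list_cost (forest_sizes c) + \sum_(r <- [seq pot s | s <- c]) r.

Definition pots l : R := \sum_(t <- l) pot t.

Definition bpot t : R :=
  buffer_cost (forest_sizes (children t)) + pots (children t).

Definition bpots l : R := \sum_(t <- l) bpot t.

(* A root in the root list pays for both gaps next to it. *)
Definition root_cost l : R := \sum_(t <- l) (2 * lnn (tree_size t) + kappa).

Lemma potE x a c : pot (Node x a c) = list_cost (forest_sizes c) + pots c.
Proof. by rewrite /= big_map. Qed.

Lemma pots_nil : pots [::] = 0. Proof. exact: big_nil. Qed.
Lemma pots_cons t l : pots (t :: l) = pot t + pots l.
Proof. exact: big_cons. Qed.
Lemma pots_cat c l : pots (c ++ l) = pots c + pots l.
Proof. exact: big_cat. Qed.

Lemma pot_ge0 t : 0 <= pot t.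
Proof.
suff h l : 0 <= pots l by have := h [:: t]; rewrite pots_cons pots_nil addr0.
elim/forest_ind: l => [|x a c l IHc IHl]; first by rewrite pots_nil.
rewrite pots_cons potE; apply: addr_ge0 => //; apply: addr_ge0 => //.
exact: list_cost_ge0.
Qed.

Lemma pots_ge0 l : 0 <= pots l.
Proof. by apply: sumr_ge0 => t _; apply: pot_ge0. Qed.

Lemma bpots_ge0 l : 0 <= bpots l.
Proof. apply: sumr_ge0 => t _; apply: addr_ge0; last exact: pots_ge0.
exact: buffer_cost_ge0. Qed.

Lemma root_cost_ge0 l : 0 <= root_cost l.
Proof.
by apply: sumr_ge0 => t _; rewrite addr_ge0 ?mulr_ge0 ?lnn_ge0 // ltW // kappa_gt0.
Qed.

Lemma pot_bpot t : pot t <= bpot t.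
Proof. by case: t => x a c; rewrite potE lerD2r list_cost_buffer. Qed.

Lemma bpot_pot t : bpot t <= pot t + lnn (tree_size t).
Proof.
case: t => x a c; rewrite potE tree_sizeE /bpot /=.
have := @buffer_cost_list R (forest_sizes c); lra.
Qed.

Ltac count_names :=
  apply/permP => ?; rewrite -?cats1 ?(forest_names_cons, forest_names_cat) /=
    ?(count_cat, forest_names_cons) /= ?count_cat /=; lia.

Lemma forest_names_link v s t :
  perm_eq (forest_names [:: link v s t]) (forest_names [:: s; t]).
Proof.
case: s t => [x a c] [y b d]; rewrite /link /=.
by case: ifP => _; first case: v; count_names.
Qed.

Lemma sizes_perm c l :
  perm_eq (forest_names c) (forest_names l) ->
  sumn (forest_sizes c) = sumn (forest_sizes l).
Proof. by move/perm_size; rewrite !size_forest_names. Qed.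

Definition key_ge (s t : tree R) := key t <= key s.

(** Ties are broken to the right, so even with equal keys the first node is a local maximum, hence
    the leftmost one, and it loses to its only neighbour. *)
Lemma llm_step_sorted v s t l : key t <= key s ->
  llm_step v (s :: t :: l) = Node (name t) (key t) (s :: children t) :: l.
Proof.
move=> ts.
have i0 : leftmost_local_max (s :: t :: l) = 0%N.
  rewrite /leftmost_local_max /= /local_max /= /prec /nth_tree /=.
  by move: ts; rewrite le_eqVlt => /orP[/eqP->|->]; rewrite ?eqxx ?orbT.
rewrite /llm_step i0 /= /link_at /nth_tree /= /link ltNge ts /=.
by rewrite drop0.
Qed.

(* In a buffer sorted by non-increasing keys every root is linked to the next
   one, which pays for its new leftmost child with its carry. *)
Lemma llm_sorted v s l : path key_ge s l ->
  exists t, [/\ llm v (s :: l) = [:: t],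
     perm_eq (forest_names [:: t]) (forest_names (s :: l)) &
     pot t <= pot s + bpots l].
Proof.
rewrite /llm /=; elim: l s => [|t l IH] s /=.
  by move=> _; exists s; rewrite /bpots big_nil addr0; split.
case/andP=> ts pl; rewrite -iterS iterSr llm_step_sorted //.
have [|u [-> pu hu]] := IH (Node (name t) (key t) (s :: children t)).
  by case: l pl {IH} => //= r l; rewrite /key_ge.
exists u; split => //.
  apply: perm_trans pu _; case: t s {ts pl hu IH} => y b d [x a c] /=; count_names.
apply: le_trans hu _; rewrite /bpots big_cons addrA lerD2r potE pots_cons /bpot.
by have := @list_cost_cons R (tree_size s) (forest_sizes (children t)); rewrite /=; lra.
Qed.

End Trees.

(** * Leftmost locally maximum linking *)

Section Linking.
Context {R : realType}.
Implicit Types (v : variant) (t s : tree R) (c l p q : seq (tree R)).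
Implicit Types (x y W : nat) (a psi : R).
Local Notation lnn := (@lnn R).
Local Notation kappa := (@kappa R).

(** Links of a local maximum that has a left neighbour. These keep the key of the first node, so
    they can be studied behind any prefix; [MoveFirst], where the first node loses, is kept apart
    for this reason. *)
Inductive inner_move v : seq (tree R) -> seq (tree R) -> Prop :=
  | MoveRight s t u l :
      key s < key t -> key u <= key t -> key s < key u ->
      inner_move v (s :: t :: u :: l) (s :: link v t u :: l)
  | MoveLeft s t u l :
      key s < key t -> key u <= key t -> key u <= key s ->
      inner_move v (s :: t :: u :: l) (link v s t :: u :: l)
  | MoveLast s t : key s < key t -> inner_move v [:: s; t] [:: link v s t]
  | MoveCons s l l' : inner_move v l l' -> inner_move v (s :: l) (s :: l').

Lemma inner_move_cat v p l l' :
  inner_move v l l' -> inner_move v (p ++ l) (p ++ l').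
Proof. by move=> h; elim: p => //= s p; apply: MoveCons. Qed.

Inductive move v : seq (tree R) -> seq (tree R) -> Prop :=
  | MoveFirst s t l : key t <= key s -> move v (s :: t :: l) (link v s t :: l)
  | MoveInner l l' : inner_move v l l' -> move v l l'.

(** * A step of the linking procedure is a move *)

Lemma nth_tree_cat p q i : nth_tree (p ++ q) (size p + i) = nth_tree q i.
Proof. by rewrite /nth_tree nth_cat ltnNge leq_addr /= addKn. Qed.

Lemma prec_cat p q i j :
  prec (p ++ q) (size p + i) (size p + j) = prec q i j.
Proof. by rewrite /prec !nth_tree_cat ltn_add2l. Qed.

Lemma link_at_cat v p q i : link_at v (p ++ q) (size p + i) = p ++ link_at v q i.
Proof.
rewrite /link_at -!addnS !nth_tree_cat take_cat drop_cat.
by rewrite !ltnNge !leq_addr /= !addKn catA.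
Qed.

Lemma prec_asym l i : prec l i i.+1 = ~~ prec l i.+1 i.
Proof. by rewrite /prec; case: ltgtP => //=; rewrite ltnS leqnn ltnNge leqnSn. Qed.

(** Take the first position after which the order falls, the last position counting as a fall.
    Everything before it rises. *)
Lemma has_local_max l : (0 < size l)%N ->
  exists2 i, (i < size l)%N & local_max l i.
Proof.
move=> l0.
pose falls i := (i.+1 < size l)%N ==> prec l i.+1 i.
have hf : has falls (iota 0 (size l)).
  apply/hasP; exists (size l).-1; rewrite ?mem_iota ?/falls; case: (l) l0 => //= t s _.
  by rewrite ltnn.
have := hf; rewrite has_find size_iota; set i := find _ _ => il.
have fi : falls i by have := nth_find 0%N hf; rewrite nth_iota.
exists i => //; rewrite /local_max -/(falls i) fi andbT.
apply/implyP; case E : i => [//|j] _; rewrite prec_asym /=.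
have jl : (j < size l)%N by rewrite -ltnS -E ltnW.
have := @before_find _ 0%N falls (iota 0 (size l)) j.
rewrite -/i E ltnSn nth_iota // add0n.
by move=> /(_ isT)/negbT; rewrite negb_imply => /andP[].
Qed.

Lemma leftmost_local_max_spec l : (0 < size l)%N ->
  (leftmost_local_max l < size l)%N /\ local_max l (leftmost_local_max l).
Proof.
move=> /has_local_max[i il li].
have hf : has (local_max l) (iota 0 (size l)).
  by apply/hasP; exists i; rewrite ?mem_iota.
have := hf; rewrite has_find size_iota => h; split => //.
by have := nth_find 0%N hf; rewrite nth_iota.
Qed.

Lemma prec01 s t l : prec (s :: t :: l) 0 1 = (key s < key t).
Proof. by rewrite /prec /nth_tree /= andbF orbF. Qed.
Lemma prec10 s t l : prec (s :: t :: l) 1 0 = (key t <= key s).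
Proof. by rewrite /prec /nth_tree /= andbT le_eqVlt orbC. Qed.
Lemma prec21 r s t l : prec (r :: s :: t :: l) 2 1 = (key t <= key s).
Proof. by rewrite /prec /nth_tree /= andbT le_eqVlt orbC. Qed.
Lemma prec02 r s t l : prec (r :: s :: t :: l) 0 2 = (key r < key t).
Proof. by rewrite /prec /nth_tree /= andbF orbF. Qed.

Lemma llm_step_move v l : (1 < size l)%N -> move v l (llm_step v l).
Proof.
move=> l1; have [|] := @leftmost_local_max_spec l; first by case: l l1.
rewrite /llm_step; set i := leftmost_local_max l; move: i => i il.
rewrite /local_max; case: i il => [|i] il /=.
  case: l l1 il => [|s [|t l]] //= _ _.
  by rewrite prec10 /link_at /= drop0 /nth_tree /= => ts; apply: MoveFirst.
have il' : (i < size l)%N by apply: ltnW.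
rewrite -(cat_take_drop i l) (drop_nth (Node 0%N 0 [::]) il').
rewrite (drop_nth (Node 0%N 0 [::]) il).
have sp : size (take i l) = i by rewrite size_takel // ltnW.
set s := nth _ l i; set t := nth _ l i.+1.
move: (take i l) (drop i.+2 l) sp => p q sp; subst i.
(* [t] is the local maximum and [s] its left neighbour; all comparisons concern positions 0 to 2 of
   [Q]. *)
set Q := s :: t :: q.
have p01 := @prec_cat p Q 0 1; have p21 := @prec_cat p Q 2 1.
have p02 := @prec_cat p Q 0 2.
have l0 := @link_at_cat v p Q 0; have lk1 := @link_at_cat v p Q 1.
rewrite !(addn0, addn1, addn2) in p01 p21 p02 l0 lk1.
have -> : ((size p).+2 < size (p ++ Q))%N = (2 < size Q)%N.
  by rewrite size_cat -addn2 ltn_add2l.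
rewrite p01 p21 p02 (fun_if (link_at v (p ++ Q))) l0 lk1 -fun_if /Q => h.
apply: MoveInner; apply: inner_move_cat; move: h.
move: @Q p01 p21 p02 l0 lk1 => _ _ _ _ _ _.
case: q => [|u q] /=; rewrite prec01 ?prec21 ?prec02 ?andbT.
  by move=> st; rewrite /link_at /nth_tree /=; apply: MoveLast.
move=> /andP[st ut]; rewrite /link_at /nth_tree /= drop0.
by case: (ltP (key s) (key u)) => su; [apply: MoveRight | apply: MoveLeft].
Qed.

(* A node that is being linked: its current tree, its initial size, and a bound
   on the potential inside the tree. *)
Definition item : Type := tree R * nat * R.
Implicit Types (e : item) (d : seq item).

Definition itree e : tree R := e.1.1.
Definition iweight e : nat := e.1.2.
Definition ikey e : R := key (itree e).

(* [k] bounds the number of links that the node can still win.  As long as one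
   is left, a new leftmost or rightmost child has cost at most [lnn W]. *)
Definition fits (k : nat) e : Prop := exists L M,
  [/\ forest_sizes (children (itree e)) = L ++ M,
      split_cost L M + pots (children (itree e)) <= e.2,
      (0 < k -> (sumn (behead L)).+1 <= iweight e /\
                (sumn (behead (rev M))).+1 <= iweight e)%N &
      (1 < k -> (sumn L + sumn M).+1 <= iweight e)%N].

Lemma fits_le k k' e : (k' <= k)%N -> fits k e -> fits k' e.
Proof.
move=> kk [L [M [E h h1 h2]]]; exists L, M; split=> // k'0.
  by apply: h1; apply: leq_trans kk.
by apply: h2; apply: leq_trans kk.
Qed.

Lemma fits_pot k e : fits k e -> pot (itree e) <= e.2.
Proof.
case: e => [[[x a c] W] psi] [L [M [E h _ _]]].
rewrite potE; apply: le_trans h; rewrite lerD2r /=.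
by rewrite [forest_sizes _]E; apply: min_split_le.
Qed.

(* [win_left e f] and [win_right v e f]: [e] stands immediately to the left of
   [f], and [f], respectively [e], wins. *)
Definition win_left e f : item :=
  (Node (name (itree f)) (ikey f) (itree e :: children (itree f)), iweight f,
   f.2 + e.2 + lnn (iweight f)).

Definition win_right v e f : item :=
  (Node (name (itree e)) (ikey e)
     (if v is Smooth then rcons (children (itree e)) (itree f)
      else itree f :: children (itree e)), iweight e,
   e.2 + f.2 + lnn (iweight e)).

(** One remaining win bounds the cost of the new leftmost child by the logarithm of the weight.
    Afterwards [L] is what follows that child, so a further win needs a bound on all of [L], which
    two remaining wins provide. *)
Lemma fits_win_left k j e f : (k < 2)%N ->
  fits j e -> fits k.+1 f -> fits k (win_left e f).
Proof.
move=> k2 /fits_pot ps [L [M [E h /(_ isT)[h1 h1'] h2]]].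
exists (tree_size (itree e) :: L), M; split => /=.
- by rewrite E.
- rewrite pots_cons /split_cost /=.
  have : lnn (sumn (behead L)).+1 <= lnn (iweight f) by apply: ler_lnn.
  by rewrite /split_cost in h; lra.
- move=> /h2 LM; split; last exact: h1'.
  by apply: leq_ltn_trans LM; rewrite leq_addr.
- by lia.
Qed.

Lemma fits_win_right v k j e f : (k < 2)%N ->
  fits j f -> fits k.+1 e -> fits k (win_right v e f).
Proof.
(* In a slim heap the loser of a right link also becomes leftmost, so [win_right] is [win_left] with
   the arguments exchanged. The smooth case mirrors the left one on [rev M]. *)
move=> k2; case: v; first by move=> hf he; apply: (fits_win_left k2 hf he).
move=> /fits_pot ps [L [M [E h /(_ isT)[h1 h1'] h2]]].
exists L, (rcons M (tree_size (itree f))); split => /=.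
- by rewrite /forest_sizes map_rcons -/(forest_sizes _) E rcons_cat.
- rewrite -[rcons (children _) _]cats1 pots_cat pots_cons pots_nil addr0.
  rewrite /split_cost rev_rcons /=.
  have : lnn (sumn (behead (rev M))).+1 <= lnn (iweight e) by apply: ler_lnn.
  by rewrite /split_cost in h; lra.
- move=> /h2 LM; split; first exact: h1.
  by rewrite rev_rcons /= sumn_rev; apply: leq_ltn_trans LM; rewrite leq_addl.
- by lia.
Qed.

(** Counts the sides on which a node of key [a] would win against its neighbour, [None] marking an
    end of the list. The winner of a link was the larger neighbour of the loser, so its next
    neighbour on that side, if any, is smaller: each win uses up a side. *)
Definition usable (lo ro : option R) a : nat :=
  ((if lo is Some b then (a <= b)%R else false) +
   (if ro is Some b then (a < b)%R else false))%N.

Fixpoint fitting (lo : option R) d : Prop :=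
  if d is e :: d' then
    fits (usable lo (ohead [seq ikey f | f <- d']) (ikey e)) e /\
    fitting (Some (ikey e)) d'
  else True.

(* Every gap of the list causes one link, won by the [prec]-smaller of the two
   nodes next to the gap. *)
Fixpoint link_cost d : R :=
  if d is e :: ((f :: _) as d') then
    lnn (if ikey e < ikey f then iweight e else iweight f) + link_cost d'
  else 0.

(** Invariant under moves: a link turns the cost of the gap it closes into an increase of the
    winner's bound. *)
Definition total d : R := \sum_(e <- d) e.2 + link_cost d.

(** All that the node in front of [d] depends on, both for its usable sides and for the cost of its
    gap. *)
Definition head_data d := ohead [seq (ikey e, iweight e) | e <- d].

Lemma itree_win_left v e f : ikey f <= ikey e ->
  itree (win_left e f) = link v (itree e) (itree f).
Proof. by rewrite /link -/(ikey e) -/(ikey f) ltNge => ->. Qed.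

Lemma itree_win_right v e f : ikey e < ikey f ->
  itree (win_right v e f) = link v (itree e) (itree f).
Proof. by rewrite /link -/(ikey e) -/(ikey f) => ->. Qed.

(** When a local maximum with two neighbours loses, these become adjacent. Their gap is won by the
    same node as the loser's other gap, so it has the same cost. *)
Lemma inner_move_items v lo l l' d :
  inner_move v l l' -> [seq itree e | e <- d] = l -> fitting lo d ->
  exists d', [/\ [seq itree e | e <- d'] = l', fitting lo d',
    total d' = total d & head_data d' = head_data d].
Proof.
move=> mv; elim: mv lo d => {l l'}
  [s t u l st ut su|s t u l st ut us|s t st|s l l' _ IH] lo.
- case=> [|e [|f [|g d]]] //= [? ? ? ?]; subst.
  rewrite -!/(ikey _) in st ut su *.
  rewrite /usable /= st ut /= => -[he [hf [hg hd]]].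
  exists (e :: win_left f g :: d); split => //=.
  + by rewrite (itree_win_left v ut).
  + split; first by rewrite /usable /= -/(ikey g) su.
    split=> //; rewrite /usable /= -/(ikey g) leNgt su.
    apply: fits_win_left hf hg; case: (ohead _) => // b; by case: (_ < _).
  + rewrite /total !big_cons /= -/(ikey g) su st ltNge ut /=.
    case: d hg hd => [|? ?] /= _ _; lra.
- case=> [|e [|f [|g d]]] //= [? ? ? ?]; subst.
  rewrite -!/(ikey _) in st ut us *.
  rewrite /usable /= st ut leNgt st /= => -[he [hf [hg hd]]].
  exists (win_right v e f :: g :: d); split => //=.
  + by rewrite (itree_win_right v st).
  + split; last by rewrite /usable /= -/(ikey e) us.
    rewrite /usable /= -/(ikey e) ltNge us addn0.
    rewrite addn1 in he; apply: fits_win_right hf he.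
    by case: (lo) => // b; case: (_ <= _).
  + rewrite /total !big_cons /= -/(ikey e) st !ltNge us ut /=; lra.
- case=> [|e [|f [|g d]]] //= [? ?]; subst.
  rewrite -!/(ikey _) in st *.
  rewrite /usable /= st /= => -[he [hf _]].
  exists [:: win_right v e f]; split => //=.
  + by rewrite (itree_win_right v st).
  + split=> //; rewrite /usable /= -/(ikey e) addn0.
    rewrite addn1 in he; apply: fits_win_right hf he.
    by case: (lo) => // b; case: (_ <= _).
  + rewrite /total !big_cons big_nil /= st; lra.
- case=> [|e d] //= [? El] [he hd]; subst.
  have [d' [El' hd' tot hh]] := IH _ d erefl hd.
  exists (e :: d'); split => //=.
  + by rewrite El'.
  + by split=> //; case: d d' hh he {hd hd' tot El' IH} => [|f d] [|f' d'] //= [-> _] //.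
  + move: tot; rewrite /total !big_cons.
    by case: d d' hh {he hd hd' El' IH} => [|f d] [|f' d'] //= [-> ->]; lra.
Qed.

Lemma move_items v l l' d :
  move v l l' -> [seq itree e | e <- d] = l -> fitting None d ->
  exists d', [/\ [seq itree e | e <- d'] = l', fitting None d' &
    total d' = total d].
Proof.
case=> {l l'} [s t l ts|l l' mv] dl hd; last first.
  by have [d' []] := inner_move_items mv dl hd; exists d'.
case: d dl hd => [|e [|f d]] //= [? ? ?]; subst.
rewrite -!/(ikey _) in ts *.
rewrite /usable /= ts /= => -[he [hf hd]].
exists (win_left e f :: d); split => //=.
- by rewrite (itree_win_left v ts).
- split=> //; rewrite /usable /= -/(ikey f) add0n.
  apply: fits_win_left he hf; case: (ohead _) => // b; by case: (_ < _).
- rewrite /total !big_cons /= ltNge ts /=.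
  by case: d hf hd => [|? ?] /= _ _; lra.
Qed.

Lemma size_move v l l' : move v l l' -> size l = (size l').+1.
Proof.
case=> {l l'} [//|l l']; by elim=> //= s {}l {}l' _ ->.
Qed.

Lemma names_move v l l' :
  move v l l' -> perm_eq (forest_names l') (forest_names l).
Proof.
have cat_names c1 c2 p q : perm_eq (forest_names c1) (forest_names c2) ->
    perm_eq (forest_names (p ++ c1 ++ q)) (forest_names (p ++ c2 ++ q)).
  by move=> h; rewrite !forest_names_cat perm_cat2l perm_cat2r.
case=> {l l'} [s t l _|l l'].
  exact: (cat_names [:: _] [:: s; t] [::] l (forest_names_link v s t)).
elim=> {l l'} [s t u l _ _ _|s t u l _ _ _|s t _|s l l' _ IH].
- exact: (cat_names [:: _] [:: t; u] [:: s] l (forest_names_link v t u)).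
- exact: (cat_names [:: _] [:: s; t] [::] _ (forest_names_link v s t)).
- exact: forest_names_link.
- by have := cat_names _ _ [:: s] [::] IH; rewrite !cats0.
Qed.

(** * The potential after linking a whole list *)

Definition start (t : tree R) : item := (t, tree_size t, pot t).

Lemma fits_start t : fits 2 (start t).
Proof.
case: t => x a c.
have [L [M [E h]]] := min_split_ex (@split_cost R) (forest_sizes c).
have sz : (sumn (L ++ M)).+1 = tree_size (Node x a c) by rewrite -E tree_sizeE.
exists L, M; split=> //.
- by rewrite /= -h big_map.
- rewrite /iweight /= -sz sumn_cat !ltnS => _; split.
    by case: (L) => //= b L'; lia.
  have := sumn_rev M; case: (rev M) => //= b M'; lia.
- by rewrite /iweight /= -sz sumn_cat.
Qed.

Lemma fitting_start lo l : fitting lo [seq start t | t <- l].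
Proof.
elim: l lo => //= t l IH lo; split; last exact: IH.
apply: fits_le (fits_start t); rewrite /usable.
by apply: (@leq_add _ _ 1 1); [case: lo|case: (ohead _)] => // b; exact: leq_b1.
Qed.

Lemma link_cost_start l :
  link_cost [seq start t | t <- l] <= @gap_cost R (forest_sizes l).
Proof.
elim: l => //= t l IH; case: l IH => //= s l IH; rewrite lerD //.
by apply: ler_lnn; rewrite /iweight /=; case: ifP => _; rewrite ?leq_maxl ?leq_maxr.
Qed.

(** The right-hand side bounds [total] at the start, moves preserve [total], and at the end a single
    node without gaps is left. *)
Lemma llm_spec v l : (0 < size l)%N -> exists t,
  [/\ llm v l = [:: t], perm_eq (forest_names [:: t]) (forest_names l) &
      pot t <= pots l + gap_cost (forest_sizes l)].
Proof.
move=> l0; have : fitting None [seq start t | t <- l] by apply: fitting_start.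
have : total [seq start t | t <- l] <= pots l + gap_cost (forest_sizes l).
  by rewrite /total big_map lerD2l link_cost_start.
have : [seq itree e | e <- [seq start t | t <- l]] = l by rewrite -map_comp map_id.
move: [seq start t | t <- l] (pots l + _) => d B; rewrite /llm.
move: (prednK l0); move: (size l).-1 => m; elim: m l {l0} d => [|m IH] l d ls dl hB hd.
  case: d dl hB hd => [|e [|f d]] /= El; subst => //.
  rewrite /total big_cons big_nil /= !addr0 => hB [he _].
  by exists (itree e); split => //; exact: le_trans (fits_pot he) hB.
have mv : move v l (llm_step v l) by apply: llm_step_move; rewrite -ls.
have [d' [dl' hd' tot]] := move_items mv dl hd.
have [||t [E pt ht]] := IH (llm_step v l) d' _ dl' _ hd'.
- by move: (size_move mv); rewrite -ls => -[].
- by rewrite tot.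
- exists t; split=> //; first by rewrite iterSr.
  exact: perm_trans pt (names_move mv).
Qed.

Lemma llm_nil v : llm v [::] = [::] :> seq (tree R). Proof. by []. Qed.

End Linking.

(** * Splicing *)

Section Splice.
Context {R : realType}.
Implicit Types (v : variant) (t s : tree R) (c l p q : seq (tree R)).
Implicit Types (x y W : nat) (a psi : R).
Local Notation lnn := (@lnn R).
Local Notation kappa := (@kappa R).

Definition located x l : option (tree R) :=
  ohead [seq t <- flatten [seq subtrees t | t <- l] | name t == x].

Lemma located_cat x c l :
  located x (c ++ l) = if located x c is Some t then Some t else located x l.
Proof.
by rewrite /located map_cat flatten_cat filter_cat; case: [seq _ <- _ | _].
Qed.

Lemma located_cons x y a c l :
  located x (Node y a c :: l) =
  if y == x then Some (Node y a c) else located x (c ++ l).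
Proof.
by rewrite /located /= map_cat flatten_cat; case: ifP.
Qed.

Lemma locatedP x l :
  (x \in forest_names l) = (if located x l is Some t then true else false).
Proof.
rewrite /forest_names /located; elim: (flatten _) => //= s m IH.
by rewrite in_cons IH eq_sym; case: eqP.
Qed.

Lemma located_none x l : x \notin forest_names l -> located x l = None.
Proof. by rewrite locatedP; case: located. Qed.

Lemma located_name x l t : located x l = Some t -> name t = x.
Proof.
rewrite /located; elim: (flatten _) => //= s m IH.
by case: eqP => // sx [<-].
Qed.

Lemma splice_cat x f c l : splice x f (c ++ l) = splice x f c ++ splice x f l.
Proof. by rewrite /splice map_cat flatten_cat. Qed.

Lemma splice_id x f l : x \notin forest_names l -> splice x f l = l.
Proof.
elim/(@forest_ind R): l => // y a c l IHc IHl.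
rewrite forest_names_cons in_cons mem_cat !negb_or => /and3P[xy xc xl].
rewrite -cat1s splice_cat IHl //; congr cat.
by rewrite /splice /= eq_sym (negbTE xy) /= -/(splice x f c) IHc.
Qed.

Lemma splice_cons x f y a c l :
  splice x f (Node y a c :: l) =
  (if y == x then f (Node y a c) else [:: Node y a (splice x f c)]) ++
  splice x f l.
Proof. by rewrite /splice /=; case: ifP. Qed.

Lemma located_forest_le x l t : located x l = Some t ->
  pot t <= pots l /\ (tree_size t <= sumn (forest_sizes l))%N.
Proof.
elim/(@forest_ind R): l => // y a c l IHc IHl; rewrite located_cons.
have pc := pots_ge0 c; have pl := pots_ge0 l.
have lc := @list_cost_ge0 R (forest_sizes c).
rewrite pots_cons potE /= tree_sizeE; case: eqP => [_ [<-]|_].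
  by rewrite potE tree_sizeE; split; [lra|lia].
rewrite located_cat; case: (located x c) IHc => [s|] IHc.
  by move=> /IHc[h1 h2]; split; [lra|lia].
by move=> /IHl[h1 h2]; split; [lra|lia].
Qed.

(* Replacing the subtree at [x] by at most one smaller tree only shrinks the
   lists of sibling sizes, so no other cost increases. *)
Lemma splice_spec x f l t :
  uniq (forest_names l) -> located x l = Some t ->
  (size (f t) <= 1)%N -> (sumn (forest_sizes (f t)) <= tree_size t)%N ->
  [/\ perm_eq (forest_names (splice x f l) ++ forest_names [:: t])
              (forest_names l ++ forest_names (f t)),
      pots (splice x f l) + pot t <= pots l + pots (f t) &
      shrink (forest_sizes (splice x f l)) (forest_sizes l)].
Proof.
elim/(@forest_ind R): l => // y a c l IHc IHl un + f1 fs.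
move: un; rewrite forest_names_cons /= cat_uniq mem_cat negb_or.
case/and4P=> /andP[yc yl] uc /hasPn cl ul.
rewrite located_cons splice_cons; case: eqP => [yx [E]|yx].
  subst y t; rewrite (splice_id f yl); split.
    apply/permP => z; rewrite !(forest_names_cons, forest_names_cat).
    by rewrite !count_cat /= !count_cat /=; lia.
  - by rewrite pots_cat pots_cons; lra.
  - rewrite forest_sizes_cat; move: f1 fs; case: (f _) => [|z [|? ?]] //= _ zs.
      exact/ShrinkDrop/shrink_refl.
    by apply: ShrinkCons; [lia|apply: shrink_refl].
rewrite located_cat; case E: (located x c) => [s|].
  case=> st; subst s.
  have xl : x \notin forest_names l.
    by apply/negP => /cl; rewrite /= locatedP E.
  have [pc hc sc] := IHc uc E f1 fs.
  rewrite (splice_id f xl); split.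
  - apply/permP => z; move/permP/(_ z): pc.
    by rewrite cat1s !forest_names_cons !count_cat /= !count_cat /=; lia.
  - by rewrite cat1s !pots_cons !potE; have := @list_cost_shrink R _ _ sc; lra.
  - apply: ShrinkCons; last exact: shrink_refl.
    by rewrite !tree_sizeE ltnS shrink_sumn.
move=> lt; have xc : x \notin forest_names c by rewrite locatedP E.
have [pl hl sl] := IHl ul lt f1 fs.
rewrite (splice_id f xc); split.
- apply/permP => z; move/permP/(_ z): pl.
  by rewrite cat1s !forest_names_cons !count_cat /= !count_cat /=; lia.
- by rewrite cat1s !pots_cons; lra.
- by apply: ShrinkCons.
Qed.

Lemma splice_root x l :
  uniq (forest_names l) -> x \in [seq name t | t <- l] ->
  exists p t q, [/\ l = p ++ t :: q, located x l = Some t &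
    forall f, splice x f l = p ++ f t ++ q].
Proof.
elim: l => // -[y a c] l IH un; rewrite in_cons /=.
move: un; rewrite forest_names_cons /= cat_uniq mem_cat negb_or.
case/and4P=> /andP[yc yl] uc /hasPn cl ul.
rewrite located_cons eq_sym; case: eqP => [yx _|yx /= xl].
  exists [::], (Node y a c), l; split => // f.
  by rewrite splice_cons yx eqxx splice_id -?yx.
have [p [t [q [El lt sp]]]] := IH ul xl.
have xc : x \notin forest_names c.
  apply/negP => xc; have := cl x; rewrite locatedP lt => /(_ isT).
  by rewrite /= xc.
exists (Node y a c :: p), t, q; split; first by rewrite El.
  by rewrite located_cat (located_none xc).
move=> f; by rewrite splice_cons (splice_id f xc) sp; case: eqP => // /esym.
Qed.

(** Since [x] is not a root, each root keeps its place and at most its list of children shrinks;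
    [buffer_cost] is monotone under this. *)
Lemma splice_nonroot x f l t :
  uniq (forest_names l) -> located x l = Some t ->
  x \notin [seq name t | t <- l] ->
  (size (f t) <= 1)%N -> (sumn (forest_sizes (f t)) <= tree_size t)%N ->
  bpots (splice x f l) + pot t <= bpots l + pots (f t).
Proof.
elim: l => // -[y a c] l IH un + + f1 fs.
move: un; rewrite forest_names_cons /= cat_uniq mem_cat negb_or.
case/and4P=> /andP[yc yl] uc /hasPn cl ul.
rewrite located_cons splice_cons in_cons negb_or eq_sym => + /andP[yx xl].
rewrite (negbTE yx) located_cat; case E: (located x c) => [s|].
  case=> st; subst s.
  have xl' : x \notin forest_names l.
    by apply/negP => /cl; rewrite /= locatedP E.
  have [pc hc sc] := splice_spec uc E f1 fs.
  rewrite (splice_id f xl') /bpots /= !big_cons /bpot /=.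
  by have := @buffer_cost_shrink R _ _ sc; lra.
move=> lt; have xc : x \notin forest_names c by rewrite locatedP E.
have := IH ul lt xl f1 fs.
rewrite (splice_id f xc) /bpots /= !big_cons; lra.
Qed.

Lemma root_costE l :
  root_cost l = \sum_(n <- forest_sizes l) (2 * lnn n + kappa).
Proof. by rewrite /root_cost big_map. Qed.

Lemma root_cost_shrink c l :
  shrink (forest_sizes c) (forest_sizes l) -> root_cost c <= root_cost l.
Proof.
rewrite !root_costE; have k0 := @kappa_gt0 R.
elim=> [|m' n m _ IH|m' n' n m le _ IH]; first by rewrite !big_nil.
  by rewrite big_cons; have := @lnn_ge0 R n; lra.
by rewrite !big_cons; have := @ler_lnn R _ _ le; lra.
Qed.

Lemma shrink_size m' m : shrink m' m -> (size m' <= size m)%N.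
Proof. by elim=> //= *; lia. Qed.

End Splice.

(** * Emptying the buffer and delete-min *)

Section Operations.
Context {R : realType}.
Implicit Types (v : variant) (t s : tree R) (c l p q : seq (tree R)).
Implicit Types (x y W : nat) (a psi : R) (h : heap R).
Local Notation lnn := (@lnn R).
Local Notation kappa := (@kappa R).

Definition hpot h : R :=
  pots (roots h) + bpots (buffer h) + root_cost (roots h).

Lemma nodesE h : nodes h = forest_names (roots h) ++ forest_names (buffer h).
Proof. exact: forest_names_cat. Qed.

Lemma hsizeE h : hsize h = size (nodes h).
Proof. by rewrite /hsize /nodes size_map. Qed.

Lemma hsize_sumn h :
  hsize h = (sumn (forest_sizes (roots h)) + sumn (forest_sizes (buffer h)))%N.
Proof. by rewrite hsizeE nodesE size_cat !size_forest_names. Qed.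

Lemma bpots_cat c l : bpots (c ++ l) = bpots c + bpots l.
Proof. exact: big_cat. Qed.
Lemma bpots_cons t l : bpots (t :: l) = bpot t + bpots l.
Proof. exact: big_cons. Qed.
Lemma bpots_nil : bpots [::] = 0 :> R. Proof. exact: big_nil. Qed.
Lemma root_cost_cat c l : root_cost (c ++ l) = root_cost c + root_cost l.
Proof. exact: big_cat. Qed.
Lemma root_cost_cons t l :
  root_cost (t :: l) = 2 * lnn (tree_size t) + kappa + root_cost l.
Proof. exact: big_cons. Qed.
Lemma root_cost_nil : root_cost [::] = 0 :> R. Proof. exact: big_nil. Qed.

Lemma hpot_ge0 h : 0 <= hpot h.
Proof.
by rewrite /hpot addr_ge0 ?root_cost_ge0 // addr_ge0 ?pots_ge0 ?bpots_ge0.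
Qed.

Lemma add_root_roots t h : exists p q,
  roots h = p ++ q /\ add_root t h = Heap (p ++ t :: q) (buffer h).
Proof.
rewrite /add_root; set b := (X in if X then _ else _); case: b.
  by exists [::], (roots h).
by exists (take 1 (roots h)), (drop 1 (roots h)); rewrite cat_take_drop.
Qed.

Lemma add_root_spec t h :
  [/\ buffer (add_root t h) = buffer h,
      perm_eq (nodes (add_root t h)) (forest_names [:: t] ++ nodes h) &
      hpot (add_root t h) = hpot h + pot t + (2 * lnn (tree_size t) + kappa)].
Proof.
have [p [q [E ->]]] := add_root_roots t h; split => //.
  rewrite !nodesE /= E -[t :: q]cat1s.
  by apply/permP => z; rewrite !forest_names_cat !count_cat; lia.
by rewrite /hpot /= E !pots_cat !root_cost_cat pots_cons root_cost_cons; ring.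
Qed.

(** The permutation is one of positions, as [perm_eq] asks for an [eqType] and [tree R] is not made
    one. *)
Lemma sort_buffer_perm l : exists2 r : seq nat,
  perm_eq r (iota 0 (size l)) & sort_buffer l = [seq nth_tree l i | i <- r].
Proof.
have El : l = [seq nth_tree l i | i <- iota 0 (size l)].
  by rewrite /nth_tree -/(mkseq _ _) mkseq_nth.
pose r : rel (tree R) := fun s t => key t <= key s.
exists (sort (relpre (nth_tree l) r) (iota 0 (size l))); first by rewrite perm_sort.
by rewrite /sort_buffer -/r {1}El sort_map.
Qed.

Lemma forest_names_count (z : pred nat) l :
  count z (forest_names l) = (\sum_(t <- l) count z (forest_names [:: t]))%N.
Proof.
elim: l => [|t l IH]; first by rewrite big_nil.
by rewrite big_cons -IH -cat1s forest_names_cat count_cat.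
Qed.

Lemma sort_buffer_names l :
  perm_eq (forest_names (sort_buffer l)) (forest_names l).
Proof.
have [r pr ->] := sort_buffer_perm l; apply/permP => z.
rewrite !forest_names_count big_map (perm_big _ pr) /=.
rewrite -(big_map _ xpredT (fun t => count z (forest_names [:: t]))).
by rewrite -/(mkseq _ _) mkseq_nth.
Qed.

Lemma sort_buffer_bpots l : bpots (sort_buffer l) = bpots l.
Proof.
have [r pr ->] := sort_buffer_perm l.
rewrite /bpots big_map (perm_big _ pr) /=.
by rewrite -(big_map (nth_tree l) xpredT bpot) -/(mkseq _ _) mkseq_nth.
Qed.

(** The potential of the linked tree is covered by that of the buffer roots; what has to be added is
    the root cost of the one new root. *)
Lemma empty_buffer_spec v h h' time : empty_buffer v h = (h', time) ->
  [/\ buffer h' = [::], perm_eq (nodes h') (nodes h),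
      hpot h' <= hpot h + 2 * lnn (hsize h) + kappa &
      kappa * time%:R <= @beta R (size (buffer h))].
Proof.
rewrite /empty_buffer; case=> <- <-; have k0 := @kappa_gt0 R.
have l0 := @lnn_ge0 R (hsize h).
have tm := @sorting_time R (size (buffer h)).
have sn := sort_buffer_names (buffer h).
have sb := sort_buffer_bpots (buffer h).
have srt : sorted (@key_ge R) (sort_buffer (buffer h)).
  by apply: sort_sorted => s t; apply: le_total.
case: (sort_buffer _) sn sb srt => [|s l] sn sb srt.
  rewrite llm_nil /=; split => //.
    by rewrite !nodesE /= /forest_names /= perm_cat2l.
  by rewrite /hpot /= -sb bpots_nil; lra.
have [u [-> un pu]] := llm_sorted v srt.
rewrite [foldr _ _ _]/(add_root u _).
have [-> pn ->] := add_root_spec u (Heap (roots h) [::]).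
have un' := perm_trans un sn.
split => //.
  apply: perm_trans pn _; apply/permP => z; rewrite !nodesE /= !count_cat.
  by move/permP/(_ z): un' => ->; rewrite /= addn0 addnC.
have us : (tree_size u <= hsize h)%N.
  by have := sizes_perm un'; rewrite hsize_sumn /=; lia.
have := @ler_lnn R _ _ us.
(* The first root in sorted order wins no link, so its carry is dropped. *)
have := pot_bpot s.
rewrite /hpot /= -sb bpots_nil bpots_cons; lra.
Qed.

Lemma gap_cost_roots l :
  kappa * (size l)%:R + gap_cost (forest_sizes l) <= root_cost l.
Proof.
have lmax m n : lnn (maxn m n) <= lnn m + lnn n.
  have := @lnn_ge0 R m; have := @lnn_ge0 R n.
  by rewrite /maxn; case: ifP; lra.
(* The first root borders a single gap. Its spare logarithm is kept for the root put in front of it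
   in the induction. *)
suff h m : gap_cost m + lnn (head 0%N m) <= \sum_(n <- m) 2 * lnn n.
  have := h (forest_sizes l); have := @lnn_ge0 R (head 0%N (forest_sizes l)).
  rewrite root_costE big_split /= big_const_seq count_predT iter_addr_0.
  rewrite size_map mulr_natr; lra.
elim: m => [|n m IH]; first by rewrite big_nil lnn0 addr0.
rewrite big_cons; case: m IH => [|k m] /= IH.
  by rewrite big_nil add0r; have := @lnn_ge0 R n; lra.
by have := lmax n k; lra.
Qed.

Lemma llm_time_le m : kappa * (llm_time m)%:R <= 2 * (kappa * m%:R).
Proof.
rewrite mulrCA ler_pM2l ?kappa_gt0 // -natrM ler_nat /llm_time; lia.
Qed.

(** The gap bounds release [kappa] per linked node while linking takes up to two units per node, so
    the potential enters doubled. Logarithms: 13 for the children, 1 for the junction with the other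
    roots, 2 for the new root, 2 for emptying the buffer; twice 18 is below 40. *)
Lemma delete_min_spec v h h' time : delete_min v h = (h', time) ->
  [/\ buffer h' = [::], exists z : seq nat, perm_eq (z ++ nodes h') (nodes h) &
      2 * hpot h' + kappa * time%:R <=
      2 * hpot h + @beta R (size (buffer h)) + 40 * lnn (hsize h).+1 + 40].
Proof.
rewrite /delete_min; case E: (empty_buffer v h) => [h1 te].
have [b1 n1 c1 t1] := empty_buffer_spec E.
have k0 := @kappa_gt0 R; have k1 := @kappa_le1 R.
have n0 := @ler_lnn R _ _ (leqnSn (hsize h)).
have l0 := @lnn_ge0 R (hsize h).+1.
case Er: (roots h1) => [|[x a c] rs] [<- <-].
  split=> //; first by exists [::].
  lra.
rewrite /=; split => //.
  exists [:: x].
  apply: perm_trans _ n1; rewrite [in X in perm_eq _ X]nodesE b1 Er cats0.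
  rewrite forest_names_cons perm_cons -forest_names_cat nodesE cats0 /=.
  have [s0|s0] := posnP (size (c ++ rs)).
    by rewrite (size0nil s0).
  by have [t [-> ]] := llm_spec v s0.
have hs : (sumn (forest_sizes (c ++ rs)) < hsize h)%N.
  rewrite (_ : hsize h = hsize h1); last by rewrite !hsizeE (perm_size n1).
  rewrite hsize_sumn Er /= tree_sizeE forest_sizes_cat sumn_cat; lia.
have hc : lnn (sumn (forest_sizes c)).+1 <= lnn (hsize h).+1.
  by apply: ler_lnn; move: hs; rewrite forest_sizes_cat sumn_cat; lia.
have hl : lnn (sumn (forest_sizes (c ++ rs))) <= lnn (hsize h).+1.
  by apply: ler_lnn; lia.
have := llm_time_le (size (c ++ rs)); rewrite size_cat natrD mulrDr.
have := gap_cost_roots rs.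
have := @gap_cost_list R _ (forest_sizes_pos c).
have := @gap_cost_cat R (forest_sizes c) (forest_sizes rs).
rewrite -forest_sizes_cat /forest_sizes !size_map -!/(forest_sizes _).
move: c1; rewrite {1}/hpot b1 Er bpots_nil pots_cons potE root_cost_cons.
have ls := @lnn_ge0 R (tree_size (Node x a c)).
have lc0 := @list_cost_ge0 R (forest_sizes c).
rewrite [(te + _)%:R]natrD (mulrDr kappa te%:R).
have [s0|s0] := posnP (size (c ++ rs)).
  rewrite (size0nil s0) /hpot /= /llm /= pots_nil bpots_nil root_cost_nil.
  have := pots_ge0 c; have := pots_ge0 rs; have := root_cost_ge0 rs.
  have := @gap_cost_ge0 R (forest_sizes c).
  have := @gap_cost_ge0 R (forest_sizes rs).
  lra.
have [t [-> tn pt]] := llm_spec v s0.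
rewrite /hpot /= pots_cons pots_nil bpots_nil root_cost_cons root_cost_nil.
have hst : lnn (tree_size t) <= lnn (hsize h).+1.
  apply: ler_lnn; have := sizes_perm tn; rewrite /=; lia.
rewrite pots_cat in pt; lra.
Qed.

End Operations.

(** * Decrease-key and delete *)

Section Cuts.
Context {R : realType}.
Implicit Types (v : variant) (t s : tree R) (c l p q : seq (tree R)).
Implicit Types (x y W : nat) (a psi : R) (h : heap R).
Local Notation lnn := (@lnn R).
Local Notation kappa := (@kappa R).

Definition heap_splice x (f : tree R -> seq (tree R)) h : heap R :=
  Heap (splice x f (roots h)) (splice x f (buffer h)).

Lemma splice_part x l1 l2 t :
  uniq (forest_names (l1 ++ l2)) -> located x (l1 ++ l2) = Some t ->
  located x l1 = Some t /\ x \notin forest_names l2 \/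
  x \notin forest_names l1 /\ located x l2 = Some t.
Proof.
rewrite forest_names_cat cat_uniq => /and3P[_ /hasPn ul _].
rewrite located_cat; case E: (located x l1) => [s|] lt.
  left; split=> //; apply/negP => /ul /=; by rewrite locatedP E.
by right; split=> //; rewrite locatedP E.
Qed.

Lemma root_name x l : x \in [seq name t | t <- l] -> x \in forest_names l.
Proof.
elim: l => // -[y a c] l IH; rewrite forest_names_cons !in_cons mem_cat.
by case/orP=> [/= ->|/IH ->] //; rewrite !orbT.
Qed.

Lemma pots_bpots l : pots l <= bpots l.
Proof. by apply: ler_sum => t _; apply: pot_bpot. Qed.

Lemma bpots_pots l :
  (size l <= 1)%N -> bpots l <= pots l + lnn (sumn (forest_sizes l)).
Proof.
case: l => [|t [|? ?]] //= _; first by rewrite bpots_nil pots_nil lnn0 addr0.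
by rewrite bpots_cons bpots_nil pots_cons pots_nil !addr0 addn0 bpot_pot.
Qed.

(** Shared by cutting and deleting. For a root the bound serves both the root list and the buffer,
    so the replacement is charged the buffer potential and the root cost together. *)
Lemma heap_splice_spec x f h t :
  uniq (nodes h) -> find_node x h = Some t ->
  (size (f t) <= 1)%N -> (sumn (forest_sizes (f t)) <= tree_size t)%N ->
  [/\ perm_eq (nodes (heap_splice x f h) ++ forest_names [:: t])
              (nodes h ++ forest_names (f t)),
      (size (buffer (heap_splice x f h)) <= size (buffer h))%N,
      (tree_size t <= hsize h)%N &
      if is_root x h
      then hpot (heap_splice x f h) + bpot t <=
           hpot h + bpots (f t) + root_cost (f t)
      else hpot (heap_splice x f h) + pot t <= hpot h + pots (f t)].
Proof.
move=> un ft f1 fs; have := splice_part un ft.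
have [ur ub] : uniq (forest_names (roots h)) /\ uniq (forest_names (buffer h)).
  by move: un; rewrite nodesE cat_uniq => /and3P[].
rewrite /is_root map_cat mem_cat => -[[lr xb]|[xr lb]].
  have [pn hp sh] := splice_spec ur lr f1 fs.
  have rc := root_cost_shrink sh.
  rewrite /heap_splice (splice_id f xb); split.
  - apply/permP => z; move/permP/(_ z): pn.
    by rewrite !nodesE /= !count_cat; lia.
  - by [].
  - by rewrite hsize_sumn; have := (located_forest_le lr).2; lia.
  - have -> : (x \in [seq name t | t <- buffer h]) = false.
      by apply/negP => /root_name; apply/negP.
    rewrite orbF /hpot /=; case: ifP => xr; last by lra.
    have [p [s [q [Er ls sp]]]] := splice_root ur xr.
    move: ls; rewrite lr => -[?]; subst s.
    rewrite sp Er !pots_cat !root_cost_cat pots_cons root_cost_cons.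
    (* The root cost released by [t] makes up the difference between [pot t] and [bpot t]. *)
    have := bpot_pot t; have := pots_bpots (f t); have := @lnn_ge0 R (tree_size t).
    have := @kappa_gt0 R; lra.
have [pn hp sh] := splice_spec ub lb f1 fs.
rewrite /heap_splice (splice_id f xr); split.
- apply/permP => z; move/permP/(_ z): pn.
  by rewrite !nodesE /= !count_cat; lia.
- by have := shrink_size sh; rewrite !size_map.
- by rewrite hsize_sumn; have := (located_forest_le lb).2; lia.
- have -> : (x \in [seq name t | t <- roots h]) = false.
    by apply/negP => /root_name; apply/negP.
  rewrite orFb /hpot /=; case: ifP => xb.
    have [p [s [q [Er ls sp]]]] := splice_root ub xb.
    move: ls; rewrite lb => -[?]; subst s.
    rewrite sp Er !bpots_cat bpots_cons; have := root_cost_ge0 (f t); lra.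
  by have := splice_nonroot ub lb (negbT xb) f1 fs; lra.
Qed.

Lemma delete_spec v x h t :
  uniq (nodes h) -> find_node x h = Some t ->
  let h' := heap_splice x (fun t => llm v (children t)) h in
  [/\ perm_eq (x :: nodes h') (nodes h), (size (buffer h') <= size (buffer h))%N &
      2 * hpot h' + kappa * (llm_time (size (children t)))%:R <=
      2 * hpot h + 40 * lnn (hsize h).+1 + 40].
Proof.
move=> un ft h'; pose f (t : tree R) := llm v (children t).
have [f1 fn fp] : [/\ (size (f t) <= 1)%N,
    perm_eq (forest_names (f t)) (forest_names (children t)) &
    pots (f t) + kappa * (size (children t))%:R <=
    pot t + 13 * lnn (tree_size t) + 2 * kappa].
  case: t {ft} @f => y a c; rewrite potE tree_sizeE /=.
  have := @gap_cost_list R _ (forest_sizes_pos c); rewrite size_map.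
  have [c0|c0] := posnP (size c).
    rewrite (size0nil c0) => hg; split => //; rewrite !pots_nil mulr0.
    by have := @list_cost_ge0 R [::]; have := @kappa_gt0 R; rewrite lnn1; lra.
  have [s [-> sn sp]] := llm_spec v c0 => hg; split => //.
  by rewrite pots_cons pots_nil; lra.
have tn : forest_names [:: t] = x :: forest_names (children t).
  by rewrite -(located_name ft); case: (t) => y a c; rewrite forest_names_cons cats0.
have fsz : (sumn (forest_sizes (f t)) <= tree_size t)%N.
  by rewrite (sizes_perm fn); case: (t) => y a c; rewrite tree_sizeE.
have [hn hb ht hp] := heap_splice_spec un ft f1 fsz.
split=> //.
  rewrite -/f in h' *; apply/permP => z.
  move/permP/(_ z): hn; move/permP/(_ z): fn; rewrite tn !count_cat /= -/h'; lia.
(* A replacement root costs at most one logarithm for its carry and two, plus [kappa], as root cost.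
   With the 13 for linking the children this makes 16, or 32 after doubling. *)
have {}hp : hpot h' + pot t <= hpot h + pots (f t) + 3 * lnn (tree_size t) + kappa.
  have := pot_bpot t; have := bpots_pots f1.
  have := @lnn_ge0 R (tree_size t); have := @kappa_gt0 R.
  have := @ler_lnn R _ _ fsz.
  have : root_cost (f t) <= 2 * lnn (sumn (forest_sizes (f t))) + kappa.
    case: (f t) f1 => [|s [|? ?]] //= _; rewrite ?root_cost_cons root_cost_nil.
      by rewrite lnn0 mulr0 add0r ltW // kappa_gt0.
    by rewrite addn0 addr0.
  by case: ifP hp; rewrite -/f -/h'; lra.
have lt : lnn (tree_size t) <= lnn (hsize h).+1 by apply: ler_lnn; lia.
have := @llm_time_le R (size (children t)); have := @kappa_le1 R.
have := @kappa_gt0 R.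
have := @lnn_ge0 R (hsize h).+1.
lra.
Qed.

(** Cutting does not raise [hpot]: sibling lists only shrink, and the buffer potential of [x] is
    already there. If [x] is a root it is released by the splice; otherwise [buffer_cost_behead]
    obtains it from the former cost of the leftmost child. *)
Lemma detach_spec x a h t :
  uniq (nodes h) -> find_node x h = Some t ->
  [/\ perm_eq (nodes (detach x a h)) (nodes h),
      (size (buffer (detach x a h)) <= (size (buffer h)).+1)%N &
      hpot (detach x a h) <= hpot h].
Proof.
move=> un ft; rewrite /detach ft.
have tn : forest_names [:: t] = x :: forest_names (children t).
  by rewrite -(located_name ft); case: (t) => y b c; rewrite forest_names_cons cats0.
have hpE l b s : hpot (Heap l (rcons b s)) = hpot (Heap l b) + bpot s :> R.
  by rewrite /hpot /= -cats1 bpots_cat bpots_cons bpots_nil addr0; ring.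
have nE l b s :
    perm_eq (nodes (Heap l (rcons b s))) (nodes (Heap l b) ++ forest_names [:: s]).
  by rewrite !nodesE /= -cats1 forest_names_cat catA.
case: ifP => xr.
  have [hn hb _] := @heap_splice_spec x (fun=> [::]) h t un ft isT isT.
  rewrite xr bpots_nil root_cost_nil !addr0 => hp.
  split; last by rewrite hpE; apply: le_trans hp; rewrite lerD2l /bpot.
    apply: perm_trans (nE _ _ _) _; move: hn; rewrite tn /= cats0.
    by rewrite (forest_names_cons x a (children t) [::]) cats0.
  by rewrite size_rcons ltnS.
set y := take 1 _; set k := drop 1 _.
have y1 : (size y <= 1)%N by rewrite size_take_min geq_minl.
have ys : (sumn (forest_sizes y) <= tree_size t)%N.
  case: (t) @y {k y1 ft tn} => z b c; rewrite tree_sizeE /=.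
  by case: c => [|s c] //=; rewrite take0 /=; lia.
have [hn hb _] := @heap_splice_spec x (fun=> y) h t un ft y1 ys.
rewrite xr => hp; split.
- apply: perm_trans (nE _ _ _) _; apply/permP => z; move/permP/(_ z): hn.
  rewrite tn -{1}(cat_take_drop 1 (children t)) -/y -/k forest_names_cat.
  rewrite !count_cat forest_names_cons cats0 /= count_cat /heap_splice; lia.
- by rewrite size_rcons ltnS.
- rewrite hpE; suff : bpot (Node x a k) + pots y <= pot t.
    by move: hp; rewrite /heap_splice; lra.
  have -> : pot t = list_cost (forest_sizes (children t)) + pots (children t).
    by case: (t) => z b c; rewrite potE.
  rewrite /bpot /= /y /k; case: (children t) => [|s c] /=.
    rewrite pots_nil !addr0; apply: le_trans (min_split_le _ [::] [::]) _.
    by rewrite /carry /= lnn1 /split_cost /= !addr0; apply: list_cost_ge0.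
  rewrite take0 drop0 !pots_cons pots_nil.
  have := @buffer_cost_behead R (tree_size s) (forest_sizes c); lra.
Qed.

End Cuts.

(** * Amortization *)

Section Amortization.
Context {R : realType}.
Implicit Types (v : variant) (t s : tree R) (c l p q : seq (tree R)).
Implicit Types (x y i j : nat) (a psi : R) (h : heap R) (st : state R).
Implicit Types (op : operation R).
Local Notation lnn := (@lnn R).
Local Notation kappa := (@kappa R).

(* The logarithmic term of the smaller heap pays for emptying its buffer in a
   meld; it grows by O(1) for the larger one. *)
Definition Phi h : R :=
  2 * hpot h + 4 * lnn (hsize h).+1 + 6 * beta (size (buffer h)).

Lemma Phi_ge0 h : 0 <= Phi h.
Proof.
have := hpot_ge0 h; have := @lnn_ge0 R (hsize h).+1.
have := @beta_ge R (size (buffer h)).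
have : (0 : R) <= (size (buffer h))%:R by [].
rewrite /Phi; lra.
Qed.

Lemma Phi_empty : Phi (Heap [::] [::]) = 0.
Proof.
by rewrite /Phi /hpot /= pots_nil bpots_nil root_cost_nil beta0 lnn1; lra.
Qed.

Lemma hsize_perm h z h' : perm_eq (z ++ nodes h') (nodes h) ->
  hsize h = (size z + hsize h')%N.
Proof. by move/perm_size; rewrite size_cat !hsizeE => ->. Qed.

Lemma kappa_succ n : kappa * n.+1%:R = kappa * n%:R + kappa.
Proof. by rewrite -natr1 mulrDr mulr1. Qed.

Lemma lnnS_le n : lnn n.+1 <= lnn n + kappa.
Proof.
case: n => [|n]; first by rewrite lnn1 lnn0 add0r ltW // kappa_gt0.
rewrite addrC /kappa -lnnM //; apply: ler_lnn; lia.
Qed.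

Lemma lnn_lg n : lnn n <= lg n%:R.
Proof.
have k0 := @kappa_gt0 R; have k1 := @kappa_le1 R.
rewrite /lg -/(lnn n) -/kappa ler_pdivlMr //.
by apply: ler_piMr => //; apply: lnn_ge0.
Qed.

Lemma lg_bound n : lnn n.+1 + 1 <= 2 * (1 + lg n%:R).
Proof.
have := lnnS_le n; have := lnn_lg n; have := @kappa_le1 R.
have := @lnn_ge0 R n; lra.
Qed.

(** * Amortized cost of each operation *)

Lemma Phi_insert x a h :
  perm_eq (nodes (insert x a h)) (x :: nodes h) /\
  kappa + Phi (insert x a h) <= Phi h + 100.
Proof.
have [eb pn hp] := add_root_spec (Node x a [::]) h.
rewrite -/(insert x a h) in eb pn hp.
split; first by apply: perm_trans pn _; rewrite forest_names_cons.
have hs : hsize (insert x a h) = (hsize h).+1.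
  by rewrite !hsizeE (perm_size pn) size_cat forest_names_cons.
have p0 : pot (Node x a [::]) <= 0 :> R.
  rewrite potE pots_nil addr0; apply: le_trans (min_split_le _ [::] [::]) _.
  by rewrite /split_cost /= addr0.
have := lnnS_le (hsize h).+1; have := @kappa_le1 R.
rewrite /Phi eb hs hp -[tree_size _]/1%N lnn1; lra.
Qed.

Lemma cat_roots_cases l1 l2 :
  cat_roots l1 l2 = l1 ++ l2 \/ cat_roots l1 l2 = l2 ++ l1.
Proof.
case: l1 l2 => [|s l1] [|t l2]; rewrite /cat_roots; try by left.
by case: ifP; [right|left].
Qed.

Lemma Phi_join h1 h2 r : buffer h1 = [::] ->
  r = roots h1 ++ roots h2 \/ r = roots h2 ++ roots h1 ->
  let h := Heap r (buffer h2) in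
  perm_eq (nodes h) (nodes h1 ++ nodes h2) /\ hpot h = hpot h1 + hpot h2 :> R.
Proof.
rewrite /hpot => b1 hr; rewrite b1 bpots_nil /=; split.
  apply/permP => z; rewrite !nodesE b1 /=.
  by case: hr => ->; rewrite !forest_names_cat !count_cat /=; lia.
by case: hr => ->; rewrite !pots_cat !root_cost_cat; ring.
Qed.

Lemma Phi_meld_le v h1 h2 h time r :
  empty_buffer v h1 = (h, time) -> (hsize h1 <= hsize h2)%N ->
  r = roots h ++ roots h2 \/ r = roots h2 ++ roots h ->
  perm_eq (nodes (Heap r (buffer h2))) (nodes h1 ++ nodes h2) /\
  kappa * time.+1%:R + Phi (Heap r (buffer h2)) <= Phi h1 + Phi h2 + 100.
Proof.
move=> /empty_buffer_spec[b1 n1 c1 t1] le12 hr.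
have [pn hp] := Phi_join b1 hr.
have {}pn : perm_eq (nodes (Heap r (buffer h2))) (nodes h1 ++ nodes h2).
  by apply: perm_trans pn _; rewrite perm_cat2r.
split=> //; rewrite /Phi hp /=.
have -> : hsize (Heap r (buffer h2)) = (hsize h1 + hsize h2)%N.
  by rewrite !hsizeE (perm_size pn) size_cat.
have : lnn (hsize h1 + hsize h2).+1 <= kappa + lnn (hsize h2).+1.
  by rewrite /kappa -lnnM //; apply: ler_lnn; lia.
have := @ler_lnn R _ _ (leqnSn (hsize h1)).
have := @kappa_le1 R; have := @kappa_gt0 R.
have := @beta_ge R (size (buffer h1)).
have : (0 : R) <= (size (buffer h1))%:R by [].
rewrite kappa_succ; lra.
Qed.

Lemma Phi_meld v h1 h2 h time : meld v h1 h2 = (h, time) ->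
  perm_eq (nodes h) (nodes h1 ++ nodes h2) /\
  kappa * time.+1%:R + Phi h <= Phi h1 + Phi h2 + 100.
Proof.
rewrite /meld; case: ltnP => le12; case E: empty_buffer => [h' t] [<- <-].
  exact: Phi_meld_le E (ltnW le12) (cat_roots_cases _ _).
have [] := Phi_meld_le E le12 (r := cat_roots (roots h1) (roots h')) _.
  by have := cat_roots_cases (roots h1) (roots h'); tauto.
move=> pn hP; split; last by lra.
by apply: perm_trans pn _; rewrite perm_catC.
Qed.

Lemma Phi_delete_min v h h' time : delete_min v h = (h', time) ->
  (exists z : seq nat, perm_eq (z ++ nodes h') (nodes h)) /\
  kappa * time.+1%:R + Phi h' <= Phi h + 100 * (1 + lg (hsize h)%:R).
Proof.
move=> /delete_min_spec[b' [z pz] hp]; split; first by exists z.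
have := lg_bound (hsize h).
have : lnn (hsize h').+1 <= lnn (hsize h).+1.
  by apply: ler_lnn; rewrite (hsize_perm pz); lia.
have := @kappa_le1 R; have := @lnn_ge0 R (hsize h).+1.
have := @beta_ge R (size (buffer h)).
have : (0 : R) <= (size (buffer h))%:R by [].
rewrite /Phi b' /= beta0 kappa_succ; lra.
Qed.

Lemma Phi_delete v x h h' time :
  uniq (nodes h) -> x \in nodes h -> delete v x h = (h', time) ->
  (exists z : seq nat, perm_eq (z ++ nodes h') (nodes h)) /\
  kappa * time.+1%:R + Phi h' <= Phi h + 100 * (1 + lg (hsize h)%:R).
Proof.
move=> un xh; rewrite /delete; case: eqP => _; first exact: Phi_delete_min.
have [t ft] : exists t, find_node x h = Some t.
  move: xh; rewrite [nodes h]/(forest_names _) locatedP /find_node /located.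
  by case: (ohead _) => // t _; exists t.
rewrite ft => -[<- <-].
have [pn hb hp] := delete_spec v un ft.
rewrite -/(heap_splice x (fun t => llm v (children t)) h).
set h1 := heap_splice _ _ _ in pn hb hp *.
have {}pn : perm_eq ([:: x] ++ nodes h1) (nodes h) by [].
split; first by exists [:: x].
have := lg_bound (hsize h).
have : lnn (hsize h1).+1 <= lnn (hsize h).+1.
  by apply: ler_lnn; rewrite (hsize_perm pn); lia.
have := @beta_le R _ _ hb; have := @lnn_ge0 R (hsize h).+1.
have := @kappa_le1 R.
rewrite /Phi kappa_succ; lra.
Qed.

Lemma le_max1 a : 1 <= Num.max 1 a /\ a <= Num.max 1 a.
Proof.
rewrite /Order.max; case: ifP => ha; split=> //; first exact: ltW ha.
by rewrite leNgt ha.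
Qed.

Lemma Phi_decrease_key v x a h t h' time :
  uniq (nodes h) -> find_node x h = Some t -> decrease_key v x a h = (h', time) ->
  perm_eq (nodes h') (nodes h) /\
  kappa * time.+1%:R + Phi h' <= Phi h + 100 * Num.max 1 (lg (lg (hsize h)%:R)).
Proof.
move=> un ft; rewrite /decrease_key.
have [pn hb hp] := detach_spec a un ft; move: (detach x a h) pn hb hp => h1 pn hb hp.
have hs : hsize h1 = hsize h by rewrite !hsizeE (perm_size pn).
have k0 := @kappa_gt0 R; have k1 := @kappa_le1 R.
have [m1 mlg] := le_max1 (lg (lg (hsize h)%:R)).
have bb : beta (size (buffer h1)) <= beta (size (buffer h)).+1 :> R.
  exact: beta_le.
rewrite hs; case: leP => hlg.
  (* Here [lg n] is at most the buffer size [b], so the added [4 ln n] is at most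
     [4b <= (4/3) beta b]. As [beta b] is at most twice the old value plus 4, the [6 beta] released
     covers this and the time up to a constant. *)
  move=> /empty_buffer_spec[b' pn' hp' te].
  split; first exact: perm_trans pn' pn.
  have hs' : hsize h' = hsize h by rewrite -hs !hsizeE (perm_size pn').
  have := lnn_lg (hsize h); have := lnnS_le (hsize h).
  have := @beta_succ2 R (size (buffer h)).
  have := @beta_ge R (size (buffer h1)).
  have := @lnn_ge0 R (hsize h).
  have := @beta_ge R (size (buffer h)).
  have : (0 : R) <= (size (buffer h))%:R by [].
  rewrite /Phi b' /= beta0 hs' kappa_succ.
  rewrite hs in hp'; lra.
case=> <- <-; split=> //; rewrite /Phi hs mulr1.
(* Without emptying, a longer buffer raises [beta] by at most [ln b + 4], where its new size [b] is
   below [lg n]; both summands are bounded through the maximum. *)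
suff : beta (size (buffer h1)) <=
    beta (size (buffer h)) + 5 * Num.max 1 (lg (lg (hsize h)%:R)) :> R by lra.
have [b1|b1] := leqP (size (buffer h1)) (size (buffer h)).
  by have := @beta_le R _ _ b1; lra.
have Eb : size (buffer h1) = (size (buffer h)).+1 by apply/eqP; rewrite eqn_leq hb.
rewrite Eb in hlg *; have := @beta_succ R (size (buffer h)).
suff : lnn (size (buffer h)).+1 <= lg (lg (hsize h)%:R) by lra.
have b0 : (1 : R) <= (size (buffer h)).+1%:R by rewrite ler1n.
have l1 : 1 < lg (hsize h)%:R :> R by apply: le_lt_trans hlg.
have l0 : 0 < lg (hsize h)%:R :> R by apply: lt_trans l1.
apply: (@le_trans _ _ (ln (lg (hsize h)%:R))).
  by rewrite ler_ln ?posrE // ltW.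
rewrite /(lg (lg _)) -/(lnn 2) -/kappa ler_pdivlMr //.
by apply: ler_piMr => //; rewrite ln_ge0 // ltW.
Qed.

(** Names act as pointers only while they are distinct; [splice] then replaces a single subtree. *)
Definition valid st :=
  (forall i h, st i = Some h -> uniq (nodes h)) /\
  (forall i j h h', i != j -> st i = Some h -> st j = Some h' ->
     forall x, x \in nodes h -> x \notin nodes h').

(** States are functions on all of [nat], so the sum is cut off at an [N] beyond every identifier in
    the sequence. *)
Definition potential (N : nat) st : R :=
  \sum_(i < N) (if st i is Some h then Phi h else 0).

Definition Phi_option (o : option (heap R)) : R := if o is Some h then Phi h else 0.

Lemma potential_ge0 N st : 0 <= potential N st.
Proof. by apply: sumr_ge0 => i _; case: (st i) => // h; apply: Phi_ge0. Qed.

Lemma potential_update N st i o : (i < N)%N ->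
  potential N (update st i o) + Phi_option (st i) = potential N st + Phi_option o.
Proof.
move=> iN; rewrite /potential !(bigD1 (Ordinal iN) isT) /= {1}/update eqxx.
rewrite (eq_bigr (fun j : 'I_N => if st j is Some h then Phi h else 0)).
  by rewrite -!/(Phi_option _); ring.
by move=> j ji; rewrite /update (negbTE (ji : nat_of_ord j != i)).
Qed.

Lemma valid_update st i h :
  valid st -> uniq (nodes h) ->
  (forall j k, j != i -> st j = Some k ->
     forall x, x \in nodes h -> x \notin nodes k) ->
  valid (update st i (Some h)).
Proof.
move=> [un dj] uh hd; split=> [j k|j j' k k' jj']; rewrite /update.
  by case: eqP => [_ [<-]|_ /un].
case: eqP => [ji [<-]|/eqP ji hj].
  case: eqP => [ji' [<-]|/eqP ji' hj']; last exact: hd hj'.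
  by move: jj'; rewrite ji ji' eqxx.
case: eqP => [ji' [<-]|/eqP ji' hj']; last exact: dj jj' hj hj'.
by move=> x xk; apply/negP => /(hd _ _ ji hj x); rewrite xk.
Qed.

Lemma valid_remove st i : valid st -> valid (update st i None).
Proof.
move=> [un dj]; split=> [j k|j j' k k' jj']; rewrite /update.
  by case: eqP => // _ /un.
by case: eqP => // _ hj; case: eqP => // _ hj'; apply: dj jj' hj hj'.
Qed.

Lemma valid_shrink st i h h' :
  valid st -> st i = Some h ->
  (exists z : seq nat, perm_eq (z ++ nodes h') (nodes h)) ->
  valid (update st i (Some h')).
Proof.
move=> vst hi [z pz]; have [un dj] := vst; apply: valid_update => //.
  by have := un _ _ hi; rewrite -(perm_uniq pz) cat_uniq => /and3P[].
move=> j k ji hj x xh; have ij : i != j by rewrite eq_sym.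
by apply: (dj _ _ _ _ ij hi hj); rewrite -(perm_mem pz) mem_cat xh orbT.
Qed.

Definition last_id op : nat :=
  match op with
  | MakeHeap i | FindMin i | Insert _ _ i | DeleteMin i
  | DecreaseKey _ _ i | Delete _ i => i
  | Meld i j => maxn i j
  end.

Lemma step_potential v st op n time st' N :
  valid st -> step v st op n time st' -> (last_id op < N)%N ->
  valid st' /\
  kappa * time%:R + potential N st' <= potential N st + 100 * bound op n.
Proof.
move=> vst; have [un dj] := vst; have k0 := @kappa_gt0 R; have k1 := @kappa_le1 R.
case=> {op n time st'} /=.
- move=> i hi iN; split; first by apply: valid_update.
  have := potential_update st (Some (Heap [::] [::])) iN.
  by rewrite /Phi_option hi Phi_empty; lra.
- by move=> i h hi iN; split=> //; lra.
- move=> x a i h hi fr iN; have [pn hP] := Phi_insert x a h.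
  split.
    apply: valid_update => //.
      by rewrite (perm_uniq pn) /= (fr _ _ hi) (un _ _ hi).
    move=> j k ji hj y; rewrite (perm_mem pn) in_cons => /orP[/eqP ->|yh].
      exact: fr hj.
    by rewrite eq_sym in ji; apply: (dj _ _ _ _ ji hi hj).
  by have := potential_update st (Some (insert x a h)) iN; rewrite /Phi_option hi; lra.
- move=> i j h1 h2 h time ij hi hj hm; rewrite gtn_max => /andP[iN jN].
  have [pn hP] := Phi_meld hm; split.
    apply: valid_update; first exact: valid_remove.
      rewrite (perm_uniq pn) cat_uniq (un _ _ hi) (un _ _ hj) /= andbT.
      by apply/hasPn; rewrite eq_sym in ij; apply: (dj _ _ _ _ ij hj hi).
    move=> l k li; rewrite /update; case: eqP => // /eqP lj hl x.
    rewrite eq_sym in li; rewrite eq_sym in lj.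
    rewrite (perm_mem pn) mem_cat => /orP[|].
      exact: dj li hi hl x.
    exact: dj lj hj hl x.
  have := potential_update (update st j None) (Some h) iN.
  have := potential_update st None jN.
  have ei : update st j None i = Some h1 by rewrite /update (negbTE ij).
  by rewrite /Phi_option ei hj; lra.
- move=> i h h' time hi _ hd iN; have [ex hP] := Phi_delete_min hd.
  split; first exact: valid_shrink hi ex.
  by have := potential_update st (Some h') iN; rewrite /Phi_option hi; lra.
- move=> x a i h t h' time hi ft _ hd iN.
  have [pn hP] := Phi_decrease_key (un _ _ hi) ft hd.
  split; first by apply: valid_shrink hi _ => //; exists [::].
  by have := potential_update st (Some h') iN; rewrite /Phi_option hi; lra.
- move=> x i h h' time hi xh hd iN; have [ex hP] := Phi_delete (un _ _ hi) xh hd.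
  split; first exact: valid_shrink hi ex.
  by have := potential_update st (Some h') iN; rewrite /Phi_option hi; lra.
Qed.

Lemma run_potential v st ops T B st' N :
  valid st -> run v st ops T B st' -> all (fun op => last_id op < N)%N ops ->
  kappa * T%:R + potential N st' <= potential N st + 100 * B.
Proof.
move=> vst hr; elim: hr vst => {st ops T B st'} /=.
  by move=> st _ _; rewrite !mulr0 add0r addr0.
move=> st op n time st1 ops T B st2 hs _ IH vst /andP[opN opsN].
have [vst1 h1] := step_potential vst hs opN.
by have := IH vst1 opsN; rewrite natrD; lra.
Qed.

End Amortization.

Theorem theorem1 (R : realType) (v : variant) :
  exists C : R, 0 < C /\
    forall (ops : seq (operation R)) (T : nat) (B : R) (st : state R),
      run v (no_heaps R) ops T B st -> T%:R <= C * B.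
Proof.
have k0 := @kappa_gt0 R.
(* Each operation is charged at most 100 times its bound, and a unit of time is paid by [kappa]. The
   potential starts at 0 and ends nonnegative. *)
exists (100 / @kappa R); split; first by rewrite divr_gt0.
move=> ops T B st hr.
have [N opsN] : exists N, all (fun op => last_id op < N)%N ops.
  elim: {hr} ops => [|op ops [N hN]]; first by exists 0%N.
  exists (maxn (last_id op).+1 N); rewrite /= leq_maxl /=.
  by apply: sub_all hN => o; rewrite leq_max => ->; rewrite orbT.
have v0 : valid (no_heaps R) by split.
have := run_potential v0 hr opsN.
have -> : potential N (no_heaps R) = 0 by apply: big1.
have := potential_ge0 N st.
rewrite mulrAC ler_pdivlMr //; lra.
Qed.
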